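(* There exists a positive integer $d_0$ such that the following holds for all integers $d \geq d_0$. Let $n \geq d+1$ be an even integer, and let $G$ be an $(n,d,\lambda)$-graph on vertex set $[n]=\{1,\dots,n\}$ with $\lambda \leq \frac{d}{12}$. Then $G$ admits a decomposition into at most $\log_2 d + 36$ regular bipartite spanning subgraphs.
   Context: All graphs are simple and finite. For a graph $G$ on $n$ vertices with adjacency matrix $A$ and eigenvalues $\lambda_1\geq\lambda_2\geq\dots\geq\lambda_n$, set $\lambda(G):=\max\{|\lambda_2|,|\lambda_n|\}$. An $(n,d,\lambda)$-graph is a $d$-regular graph $G$ on $n$ vertices with $\lambda(G)\leq\lambda$. A decomposition of a graph $G$ is a collection of pairwise edge-disjoint subgraphs of $G$ whose edge sets together cover $E(G)$. A spanning subgraph has vertex set $V(G)$; a regular bipartite spanning subgraph is a spanning subgraph that is regular (every vertex has the same degree) and bipartite. *)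

(* Defs.v *)
From HB Require Import structures.
From mathcomp Require Import all_boot all_order all_algebra all_field.
Set Implicit Arguments. Unset Strict Implicit. Unset Printing Implicit Defensive.
Import Order.TTheory GRing.Theory Num.Theory.
Local Open Scope ring_scope.

Definition simple_graph (n : nat) (e : rel 'I_n) : Prop :=
  (forall u v, e u v = e v u) /\ (forall v, ~~ e v v).

Definition degree (n : nat) (e : rel 'I_n) (v : 'I_n) : nat := #|[set u | e v u]|.

Definition regular_of (n : nat) (e : rel 'I_n) (d : nat) : Prop :=
  forall v, degree e v = d.

Definition is_regular (n : nat) (e : rel 'I_n) : Prop :=
  exists r, regular_of e r.

Definition is_bipartite (n : nat) (e : rel 'I_n) : Prop :=
  exists c : 'I_n -> bool, forall u v, e u v -> c u != c v.

Definition adj_mx (n : nat) (e : rel 'I_n) : 'M[algC]_n :=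
  \matrix_(i, j) (e i j)%:R.

(* the eigenvalues (with multiplicity) of A, i.e. the roots of its
   characteristic polynomial, listed in non-increasing order *)
Definition eigenvalues (n : nat) (A : 'M[algC]_n) : seq algC :=
  sort (fun x y => y <= x) (sval (closed_field_poly_normal (char_poly A))).

Definition lambdaG (n : nat) (e : rel 'I_n) : algC :=
  let s := eigenvalues (adj_mx e) in
  Num.max `|nth 0 s 1| `|last 0 s|.

Definition nd_lambda_graph (n d : nat) (lam : algC) (e : rel 'I_n) : Prop :=
  simple_graph e /\ regular_of e d /\ lambdaG e <= lam.

Definition reg_bip_decomposition (n k : nat) (e : rel 'I_n) (H : 'I_k -> rel 'I_n) : Prop :=
  [/\ (forall i, simple_graph (H i)),
      (forall i u v, H i u v -> e u v),
      (forall i j u v, i != j -> ~~ (H i u v && H j u v)) &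
      (forall u v, e u v -> exists i, H i u v)] /\
  (forall i, is_regular (H i) /\ is_bipartite (H i)).

(* Main.v *)
(* Write the two sides of a bipartition as the values of a +-1 labelling that is opposite on the
   two elements of each pair of a fixed perfect matching of the vertices, so that all bipartitions
   are balanced.  The local lemma gives such labellings x and y for which every vertex has about
   d/4 neighbours in each of the four cells of (x, y).  The edges inside the cells form a graph Q
   of degree about d/4.  Bisecting Q repeatedly (the local lemma again, now with few monochromatic
   edges of Q remaining and with the edges between cells split evenly) halves its degree each time;
   when the degree is at most 2^64, a proper colouring by short binary words finishes it off.  The
   edges of Q cut at each step are completed to a regular bipartite graph by a few edges between
   different cells: such a completion exists by the bipartite f-factor theorem, whose cut
   condition follows from the expander mixing lemma because the prescribed degrees vary by a
   factor of at most 9/8.  What remains is a regular graph without edges inside the cells.  In it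
   the edges across which only x changes are completed to a regular graph by edges across which x
   and y both change; this graph is bipartite for x, and its complement is regular and bipartite
   for y. *)

(* Every completion spends edges between the cells, and this reservoir must stay above what the cut
   condition needs. For [lambda <= d / 12] that is a degree of about [(9/34 + 17/192) d < 0.354 d]
   across the bisection in use. The edges between the cells have degree about [3d/4], of which about
   [0.375 d] cross, so only a few percent of [d] may be spent in all. Hence the care for
   near-regularity: a completion costs nine times the spread of the degrees in the part cut off, and
   these spreads add up to a tiny fraction of [d], as each level halves the spread up to the
   local-lemma error. The last step has no reservoir to draw on: what is left must be decomposed
   exactly. Four cells make this possible, because an edge across which both labels change may go to
   either of the two final graphs. Opposite labels on matched vertices give sides, and opposite
   cells, of equal size. This equates the sums of prescribed degrees on both sides of every factor
   problem. *)
Require Import Defs.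
From HB Require Import structures.
From mathcomp Require Import all_boot all_order all_algebra all_field.
From mathcomp Require Import zify ring lra.
Import Order.TTheory GRing.Theory Num.Theory.
Local Open Scope ring_scope.

(** * Bipartite graphs with prescribed degrees *)

Section Factor.
Set Implicit Arguments. Unset Strict Implicit. Unset Printing Implicit Defensive.
Local Open Scope nat_scope.
Variables I J : finType.
Implicit Types (M : {set I * J}) (i : I) (j : J).

Definition outdeg M i := #|[set j | (i, j) \in M]|.
Definition indeg M j := #|[set i | (i, j) \in M]|.

Lemma outdegE M i : outdeg M i = \sum_j ((i, j) \in M).
Proof. by rewrite /outdeg -sum1_card big_mkcond; apply: eq_bigr => j _; rewrite inE; case: ifP. Qed.

Lemma indegE M j : indeg M j = \sum_i ((i, j) \in M).
Proof. by rewrite /indeg -sum1_card big_mkcond; apply: eq_bigr => i _; rewrite inE; case: ifP. Qed.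

Lemma sum_outdeg M : \sum_i outdeg M i = #|M|.
Proof.
rewrite (eq_bigr _ (fun i _ => outdegE M i)) pair_big /= -sum1_card [RHS]big_mkcond.
by apply: eq_bigr => -[i j] _ /=; case: ifP.
Qed.

Lemma sum_indeg M : \sum_j indeg M j = #|M|.
Proof.
rewrite (eq_bigr _ (fun j _ => indegE M j)) exchange_big pair_big /= -sum1_card [RHS]big_mkcond.
by apply: eq_bigr => -[i j] _ /=; case: ifP.
Qed.

Definition alternating (E : I -> J -> bool) M : rel (I + J) := fun x y =>
  match x, y with
  | inl i, inr j => E i j && ((i, j) \notin M)
  | inr j, inl i => (i, j) \in M
  | _, _ => false
  end.

Lemma outdegU1 M i j k : (i, j) \notin M ->
  outdeg ((i, j) |: M) k = outdeg M k + (k == i).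
Proof.
move=> nM; rewrite !outdegE; have [->|ki] := eqVneq k i; last first.
  by rewrite addn0; apply: eq_bigr => l _; rewrite !inE xpair_eqE (negPf ki).
rewrite (bigD1 j) //= [in RHS](bigD1 j) //= (negPf nM) !inE eqxx add0n addnC; congr (_ + _).
by apply: eq_bigr => l lj; rewrite !inE xpair_eqE (negPf lj) andbF.
Qed.

Lemma indegU1 M i j k : (i, j) \notin M ->
  indeg ((i, j) |: M) k = indeg M k + (k == j).
Proof.
move=> nM; rewrite !indegE; have [->|ki] := eqVneq k j; last first.
  by rewrite addn0; apply: eq_bigr => l _; rewrite !inE xpair_eqE (negPf ki) andbF.
rewrite (bigD1 i) //= [in RHS](bigD1 i) //= (negPf nM) !inE eqxx add0n addnC; congr (_ + _).
by apply: eq_bigr => l lj; rewrite !inE xpair_eqE (negPf lj).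
Qed.

Lemma outdegD1 M i j k : (i, j) \in M ->
  outdeg (M :\ (i, j)) k + (k == i) = outdeg M k.
Proof. by move=> ijM; rewrite -[in RHS](setD1K ijM) outdegU1 // !inE eqxx. Qed.

Lemma indegD1 M i j k : (i, j) \in M ->
  indeg (M :\ (i, j)) k + (k == j) = indeg M k.
Proof. by move=> ijM; rewrite -[in RHS](setD1K ijM) indegU1 // !inE eqxx. Qed.

Variables (E : I -> J -> bool) (f : I -> nat) (g : J -> nat).

Definition partial_factor M :=
  [/\ forall i j, (i, j) \in M -> E i j,
      forall i, outdeg M i <= f i & forall j, indeg M j <= g j].

(* Swapping the first two edges of the path moves the deficit of [i] to the next row vertex;
   since the path is simple, its tail stays alternating. *)
Lemma augment M i j p : partial_factor M -> outdeg M i < f i -> indeg M j < g j ->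
  path (alternating E M) (inl i) p -> uniq (inl i :: p) -> last (inl i) p = inr j ->
  exists2 M', partial_factor M' & #|M'| = #|M|.+1.
Proof.
elim: {p}(size p).+1 {-2}p (ltnSn (size p)) M i => // n IHn [|[//|b] p] sz M i [ME Mf Mg] fi gj //=.
case/andP=> /andP [Eib nib] pp; rewrite andbA => /andP [/andP [ip bp] up] lp.
case: p => [|[a|//] p] in sz pp ip bp up lp *.
  move: lp => /= [eb]; subst b.
  exists ((i, j) |: M); last by rewrite cardsU1 nib.
  split=> [i' j'|i'|j'].
  - by rewrite !inE => /orP [/eqP [-> ->] //|/ME].
  - by rewrite outdegU1 //; case: eqP => [->|_]; rewrite ?addn0 ?addn1.
  - by rewrite indegU1 //; case: eqP => [->|_]; rewrite ?addn0 ?addn1.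
move: pp => /= /andP [abM pp].
have ai : a != i.
  by move: ip; rewrite !inE => /norP [_ /norP []]; rewrite eq_sym.
pose M1 := (i, b) |: (M :\ (a, b)).
have nib1 : (i, b) \notin M :\ (a, b) by rewrite !inE (negPf nib) andbF.
have oM1 k : outdeg M1 k + (k == a) = outdeg M k + (k == i).
  by rewrite outdegU1 // addnAC outdegD1.
have iM1 k : indeg M1 k = indeg M k by rewrite indegU1 // indegD1.
have cM1 : #|M1| = #|M|.
  by rewrite cardsU1 nib1 (cardsD1 (a, b) M) abM.
rewrite -cM1; apply: (IHn p _ _ a).
- by move: sz; clear => /=; lia.
- split=> [i' j'|i'|j']; last by rewrite iM1.
    by rewrite !inE => /orP [/eqP [-> ->] //|/andP [_ /ME]].
  by move: (oM1 i') (Mf i') fi; case: (eqVneq i' i) => [->|_]; clear; lia.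
- by move: (oM1 a) (Mf a); rewrite eqxx (negPf ai); clear; lia.
- by rewrite iM1.
- apply: (sub_in_path (P := [pred z | z != inr b])) pp.
  + move=> [x|x] [y|y]; rewrite !inE //= => xb yb.
      case/andP=> -> /=; apply: contra; rewrite !inE => /orP [/eqP [_ yb']|/andP [] //].
      by rewrite yb' eqxx in yb.
    move=> yxM; rewrite /M1 in_setU1 in_setD1 yxM andbT !xpair_eqE; apply/orP; right.
    by apply: contra xb => /andP [_ /eqP ->].
  + apply/allP=> z zp; rewrite !inE; apply: contra bp => /eqP <-.
    by move: zp.
- exact: up.
- exact: lp.
Qed.

(** A maximum partial factor is full. If row [i] had a deficit, let [X] and [Z] be the rows and
    columns reachable from [i] by alternating paths. By [augment] every column of [Z] is saturated;
    edges of [M] into [Z] start in [X], and edges of [E] from [X] to the outside of [Z] lie in [M].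
    So the right side of the cut condition is the sum of [outdeg M] over [X], less than that of
    [f]. *)
Theorem bipartite_factor :
  \sum_i f i = \sum_j g j ->
  (forall (X : {set I}) (Z : {set J}),
    \sum_(i in X) f i <= \sum_(i in X) #|[set j in ~: Z | E i j]| + \sum_(j in Z) g j) ->
  exists M, [/\ forall i j, (i, j) \in M -> E i j,
      forall i, outdeg M i = f i & forall j, indeg M j = g j].
Proof.
move=> fg hall.
pose pf M := [&& [forall i, forall j, ((i, j) \in M) ==> E i j],
   [forall i, outdeg M i <= f i] & [forall j, indeg M j <= g j]].
have pfP M : reflect (partial_factor M) (pf M).
  apply: (iffP and3P) => -[h1 h2 h3]; split.
  - by move=> i j; move/forallP: h1 => /(_ i) /forallP /(_ j) /implyP.
  - by apply/forallP.
  - by apply/forallP.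
  - by apply/forallP=> i; apply/forallP=> j; apply/implyP; apply: h1.
  - by apply/forallP.
  - by apply/forallP.
have pf0 : pf set0.
  apply/pfP; split=> [i j|i|j]; rewrite ?inE // /outdeg /indeg.
    by rewrite (_ : [set _ | _] = set0) ?cards0 //; apply/setP=> j; rewrite !inE.
  by rewrite (_ : [set _ | _] = set0) ?cards0 //; apply/setP=> i; rewrite !inE.
case: (arg_maxnP (fun M => #|M|) pf0) => M /pfP pM Mmax.
have [ME Mf Mg] := pM.
suff full i : outdeg M i = f i.
  exists M; split=> // j; apply/eqP; have := leqnn #|M|.
  have /eqP sgM : \sum_j indeg M j == \sum_j g j.
    by rewrite sum_indeg -sum_outdeg -fg; apply/eqP/eq_bigr.
  move=> _; have /leqif_sum : forall k, true -> indeg M k <= g k ?= iff (indeg M k == g k).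
    by move=> k _; split.
  by case=> _; rewrite sgM eqxx => /esym /forallP /(_ j).
apply/eqP; rewrite eqn_leq Mf leqNgt; apply/negP => lti.
pose R := alternating E M.
pose X := [set k | connect R (inl i) (inl k)].
pose Z := [set k | connect R (inl i) (inr k)].
have satZ j : j \in Z -> indeg M j = g j.
  rewrite inE => /connectP [p pp lp]; apply/eqP; rewrite eqn_leq Mg leqNgt; apply/negP=> ltj.
  case/shortenP: pp lp => p' pp' up' _ lp.
  have [M' /pfP pM' cM'] := augment pM lti ltj pp' up' (esym lp).
  by have := Mmax M' pM'; rewrite cM' /= ltnn.
have iX : i \in X by rewrite inE connect0.
have XZ k j : k \in X -> E k j -> (j \notin Z) -> (k, j) \in M.
  rewrite !inE => ck ekj; apply: contraR => nkj.
  by apply: connect_trans ck (connect1 _); rewrite /= ekj.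
have ZX k j : (k, j) \in M -> j \in Z -> k \in X.
  by rewrite !inE => kj cj; apply: connect_trans cj (connect1 _).
have := hall X Z; apply/negP; rewrite -ltnNge.
have -> : \sum_(j in Z) g j = \sum_(k in X) \sum_(j in Z) ((k, j) \in M).
  rewrite exchange_big /=; apply: eq_bigr => j jZ; rewrite -satZ // indegE.
  rewrite [RHS]big_mkcond; apply: eq_bigr => k _.
  by case: ifP => // kX; case kj: (_ \in _) => //; rewrite (ZX _ _ kj jZ) in kX.
have -> : \sum_(k in X) #|[set j in ~: Z | E k j]| + \sum_(k in X) \sum_(j in Z) ((k, j) \in M)
   = \sum_(k in X) outdeg M k.
  rewrite -big_split; apply: eq_bigr => k kX /=; rewrite outdegE.
  rewrite [RHS](bigID [in Z]) /= addnC; congr (_ + _).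
  rewrite -sum1_card big_mkcond [RHS]big_mkcond; apply: eq_bigr => j _.
  rewrite !inE; case jZ: (connect _ _ _) => //=.
  case: ifP => [ekj|/negbT nekj]; first by rewrite XZ // inE jZ.
  by case kj: (_ \in _) => //; rewrite (ME _ _ kj) in nekj.
rewrite (bigD1 i) //= [in X in _ < X](bigD1 i) //= -addSn leq_add //.
by apply: leq_sum.
Qed.

End Factor.

(** * Prescribed degrees in expanders *)

Section ExpanderFactor.
Set Implicit Arguments. Unset Strict Implicit. Unset Printing Implicit Defensive.
Local Open Scope nat_scope.
Variable V : finType.
Implicit Types (e g q : rel V) (A B X Z S : {set V}).

Definition degin g S v := #|[set u in S | g v u]|.

Lemma deginE g S v : degin g S v = \sum_(u in S) (g v u : nat).
Proof. by rewrite /degin -sum1_card big_mkcond [RHS]big_mkcond; apply: eq_bigr => u _; rewrite inE; case: (u \in S); case: (g v u). Qed.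

Lemma sum_degin_sym g X Z : symmetric g ->
  \sum_(v in X) degin g Z v = \sum_(v in Z) degin g X v.
Proof.
move=> gs; rewrite (eq_bigr _ (fun v _ => deginE g Z v)) exchange_big.
by apply: eq_bigr => u _; rewrite deginE; apply: eq_bigr => v _; rewrite gs.
Qed.

Lemma deginID g S Z v : degin g (Z :&: S) v + degin g (Z :\: S) v = degin g Z v.
Proof. by rewrite !deginE [RHS](bigID [in S]) /=; congr (_ + _); apply: eq_bigl => u; rewrite !inE // andbC. Qed.

Lemma degin_sub e g X Z v : subrel g e -> X \subset Z -> degin g X v <= degin e Z v.
Proof.
move=> ge XZ; apply/subset_leq_card/subsetP => u; rewrite !inE => /andP [/(subsetP XZ) -> /ge ->].
by [].
Qed.

(* The expander mixing lemma with [lambda = d / 12], after bounding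
   [sqrt (|X| |Z|)] by [(|X| + |Z|) / 2] and clearing denominators. *)
Definition mixing e d := forall X Z,
  24 * #|V| * (\sum_(v in X) degin e Z v) <= 24 * d * (#|X| * #|Z|) + #|V| * d * (#|X| + #|Z|).

(** The long hypothesis says [dl >= (9/17) (m / nV) d + (17/192) d + (9/8) s]. Per vertex of a set
    of size [x], the terms bound the main term of the mixing inequality for [z <= 9m/17], its error
    [(d/24) (x + z)] for [z <= 9x/8], and the prescribed degrees [F]. *)
Lemma mixing_arith (nV d m dl s E F x z : nat) : 0 < nV ->
  192 * 9 * m * d + 289 * nV * d + 17 * 216 * s * nV <= 17 * 192 * nV * dl ->
  24 * nV * E <= 24 * d * (x * z) + nV * d * (x + z) ->
  8 * z <= 9 * x -> 17 * z <= 9 * m -> 8 * F <= 9 * s * x -> E + F <= dl * x.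
Proof.
move=> n0 H mx zx zm Fs; rewrite -(@leq_pmul2l (17 * 192 * nV)) ?muln_gt0 ?n0 //.
have h1 : 24 * d * x * (8 * (17 * z)) <= 24 * d * x * (8 * (9 * m)) by rewrite !leq_mul2l zm !orbT.
have h2 : 17 * nV * d * (8 * z) <= 17 * nV * d * (9 * x) by rewrite !leq_mul2l zx !orbT.
have h3 : 17 * 24 * nV * (8 * F) <= 17 * 24 * nV * (9 * s * x) by rewrite !leq_mul2l Fs !orbT.
have h4 := leq_mul H (leqnn x).
have h5 : 136 * (24 * nV * E) <= 136 * (24 * d * (x * z) + nV * d * (x + z)) by rewrite leq_mul2l mx.
move: h1 h2 h3 h4 h5; clear; lia.
Qed.

Variables (e g : rel V) (d m dl s : nat) (A B : {set V}) (f : V -> nat).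
Hypothesis mix_e : mixing e d.
Hypotheses (gs : symmetric g) (ge : subrel g e).
Hypothesis cB : #|B| = m.
Hypothesis fs : forall v, v \in A :|: B -> s <= f v /\ 8 * f v <= 9 * s.
Hypothesis fAB : \sum_(v in A) f v = \sum_(v in B) f v.
Hypothesis degA : forall v, v \in A -> dl <= degin g B v.
Hypothesis degB : forall v, v \in B -> dl <= degin g A v.
Hypothesis dl_large :
  192 * 9 * m * d + 289 * #|V| * d + 17 * 216 * s * #|V| <= 17 * 192 * #|V| * dl.

(** Of the at least [dl * #|W|] edges from [W] to [Q], the mixing bound lets only so many end in [Z]
    that the others suffice for [f]. The side [P] is left open because both [A] and [B] take its
    place below. *)
Lemma expansion_half (P Q W Z : {set V}) : W \subset P -> 
  (forall v, v \in P -> dl <= degin g Q v) -> P \subset A :|: B ->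
  8 * #|Z| <= 9 * #|W| -> 17 * #|Z| <= 9 * m ->
  \sum_(v in W) f v <= \sum_(v in W) degin g (Q :\: Z) v.
Proof.
move=> WP dP PAB zw zm; case: (set_0Vmem W) => [->|[w0 w0W]]; first by rewrite !big_set0.
have n0 : 0 < #|V| by rewrite (cardD1 w0).
have hF : 8 * (\sum_(v in W) f v) <= 9 * s * #|W|.
  rewrite big_distrr /= mulnC -sum_nat_const; apply: leq_sum => v vW.
  by have [] := fs (subsetP PAB _ (subsetP WP _ vW)).
have := mixing_arith n0 dl_large (mix_e W Z) zw zm hF.
have : dl * #|W| <= \sum_(v in W) degin g Q v.
  by rewrite mulnC -sum_nat_const; apply: leq_sum => v vW; apply/dP/(subsetP WP).
rewrite (eq_bigr _ (fun v _ => esym (deginID g Z Q v))) big_split /=.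
have : \sum_(v in W) degin g (Q :&: Z) v <= \sum_(v in W) degin e Z v.
  by apply: leq_sum => v _; apply: degin_sub => //; apply: subsetIr.
move: (\sum_(v in W) degin g (Q :&: Z) v) (\sum_(v in W) degin g (Q :\: Z) v)
  (\sum_(v in W) degin e Z v) (\sum_(v in W) f v) (dl * #|W|); clear; lia.
Qed.

Lemma subset_sum (P W : {set V}) : W \subset P ->
  \sum_(v in P) f v = \sum_(v in W) f v + \sum_(v in P :\: W) f v.
Proof.
move=> WP; rewrite (bigID [in W]) /=; congr (_ + _); apply: eq_bigl => v; last by rewrite inE andbC.
by case vW: (v \in W); rewrite ?andbF // (subsetP WP).
Qed.

(** Unless [Z] alone pays for [X], the 9/8 bound on the variation of [f] turns the comparison of
    sums into [8 * #|Z| <= 9 * #|X|]. The threshold [9m/17] reproduces itself under complements: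
    above it, [#|B :\: Z| < 8m/17], and [9/8] of this is [9m/17] again. *)
Lemma factor_condition X Z : X \subset A -> Z \subset B ->
  \sum_(v in X) f v <= \sum_(v in X) degin g (B :\: Z) v + \sum_(v in Z) f v.
Proof.
move=> XA ZB; case: (leqP (\sum_(v in X) f v) (\sum_(v in Z) f v)) => [le|lt].
  exact: leq_trans le (leq_addl _ _).
have ub (W : {set V}) : W \subset A :|: B -> 8 * (\sum_(v in W) f v) <= 9 * s * #|W|.
  move=> WAB; rewrite big_distrr /= mulnC -sum_nat_const; apply: leq_sum => v vW.
  by have [] := fs (subsetP WAB _ vW).
have lb (W : {set V}) : W \subset A :|: B -> s * #|W| <= \sum_(v in W) f v.
  move=> WAB; rewrite mulnC -sum_nat_const; apply: leq_sum => v vW.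
  by have [] := fs (subsetP WAB _ vW).
have cmp (W W' : {set V}) : W \subset A :|: B -> W' \subset A :|: B ->
    \sum_(v in W') f v < \sum_(v in W) f v -> 8 * #|W'| <= 9 * #|W|.
  move=> /ub h1 /lb h2 h3; apply: ltnW; rewrite ltnNge; apply/negP=> h4.
  have h5 : s * (9 * #|W|) <= s * (8 * #|W'|) by rewrite leq_mul2l h4 orbT.
  move: h1 h2 h3 h5; clear; lia.
have XAB : X \subset A :|: B by rewrite (subset_trans XA) ?subsetUl.
have ZAB : Z \subset A :|: B by rewrite (subset_trans ZB) ?subsetUr.
have AAB := subsetUl A B. have BAB := subsetUr A B.
(* If [Z] is large, pass to the complements: by [c1] and [fAB], [A :\: X] is then small. *)
case: (leqP (17 * #|Z|) (9 * m)) => [zm|zm].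
  apply: leq_trans (leq_addr _ _); apply: (expansion_half XA degA AAB) => //.
  exact: cmp.
have YB : B :\: Z \subset B by apply: subsetDl.
have XcA : A :\: X \subset A by apply: subsetDl.
have sX := subset_sum XA. have sZ := subset_sum ZB.
have lt' : \sum_(v in A :\: X) f v < \sum_(v in B :\: Z) f v.
  by move: sX sZ lt; rewrite fAB; clear; lia.
have c1 := cmp _ _ (subset_trans YB BAB) (subset_trans XcA AAB) lt'.
have c2 : 17 * #|A :\: X| <= 9 * m.
  move: c1 zm; rewrite [#|B :\: Z|]cardsD (setIidPr ZB) cB.
  have := subset_leq_card ZB; rewrite cB; clear; lia.
have := expansion_half YB degB BAB c1 c2.
rewrite setDDr setDv set0U (setIidPr XA) sum_degin_sym //.
by move: sX sZ; rewrite fAB; clear; lia.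
Qed.

Theorem expander_factor : exists M : {set V * V},
  [/\ forall u v, (u, v) \in M -> [/\ u \in A, v \in B & g u v],
      forall u, u \in A -> outdeg M u = f u & forall v, v \in B -> indeg M v = f v].
Proof.
pose E u v := [&& u \in A, v \in B & g u v].
pose fA v := if v \in A then f v else 0. pose fB v := if v \in B then f v else 0.
have [||M [ME MA MB]] := @bipartite_factor V V E fA fB.
- by rewrite -!big_mkcond.
- move=> X Z.
  have -> : \sum_(i in X) fA i = \sum_(i in X :&: A) f i.
    by rewrite -big_mkcondr /=; apply: eq_bigl => v; rewrite !inE.
  have -> : \sum_(i in Z) fB i = \sum_(i in Z :&: B) f i.
    by rewrite -big_mkcondr /=; apply: eq_bigl => v; rewrite !inE.
  apply: leq_trans (factor_condition (subsetIr X A) (subsetIr Z B)) _.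
  rewrite leq_add2r [X in X <= _]big_mkcond [X in _ <= X]big_mkcond; apply: leq_sum => v _.
  rewrite inE; case: (v \in X) => //=; case vA: (v \in A) => //=.
  apply/subset_leq_card/subsetP => u; rewrite !inE /E vA negb_and /= -andbA => /and3P [/orP [->|/negPf ub] uB ->].
    by rewrite uB.
  by rewrite uB in ub.
- exists M; split=> [u v /ME /and3P [] //|u uA|v vB]; first by rewrite MA /fA uA.
  by rewrite MB /fB vB.
Qed.

End ExpanderFactor.

(** * The expander mixing lemma *)

Section Spectral.
Set Implicit Arguments. Unset Strict Implicit. Unset Printing Implicit Defensive.
Local Open Scope sesquilinear_scope.

Lemma char_poly_conj (R : comNzRingType) n (P Q B : 'M[R]_n) : Q *m P = 1%:M ->
  char_poly (Q *m B *m P) = char_poly B.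
Proof.
move=> QP; rewrite /char_poly.
have -> : char_poly_mx (Q *m B *m P) =
    map_mx polyC Q *m char_poly_mx B *m map_mx polyC P.
  rewrite /char_poly_mx mulmxBr mulmxBl -!map_mxM; congr (_ - _).
  by rewrite mul_mx_scalar -scalemxAl -map_mxM QP map_mx1 scalemx1.
by rewrite !det_mulmx mulrAC -det_mulmx -map_mxM QP map_mx1 det1 mul1r.
Qed.

(** Ties the sorted list of roots behind [lambdaG] to the diagonal given by the spectral theorem. *)
Lemma perm_eigenvalues n (P : 'M[algC]_n) (mu : 'rV_n) : P \is unitarymx ->
  perm_eq (eigenvalues (invmx P *m diag_mx mu *m P)) [seq mu 0 i | i <- enum 'I_n].
Proof.
move=> uP; rewrite /eigenvalues perm_sort; case: closed_field_poly_normal => r /=.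
rewrite char_poly_conj ?mulVmx ?unitarymx_unit //.
rewrite (monicP (char_poly_monic _)) scale1r char_poly_trig ?diag_mx_is_trig // => Er.
apply: prod_XsubC_eq; rewrite -Er big_map enumT.
by apply: eq_bigr => i _; rewrite mxE eqxx.
Qed.

(** Whatever follows the head of the non-increasing list lies between its last and its second entry.
    The order of [algC] is total on real numbers only. *)
Lemma norm_behead_sort_le (s : seq algC) (t : algC) : all [in Num.real] s ->
  t \in behead (sort (fun x y => y <= x) s) ->
  let s' := sort (fun x y => y <= x) s in `|t| <= Num.max `|nth 0 s' 1| `|last 0 s'|.
Proof.
move=> sreal; set s' := sort _ _ => ts /=.
have realN (x : algC) : `|x| \is Num.real by rewrite normr_real.
have rs' : all [in Num.real] s' by rewrite (perm_all _ (permEl (perm_sort _ _))).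
have tot : {in [in Num.real] &, total (fun x y : algC => y <= x)}.
  by move=> x y xr yr; rewrite orbC; apply: real_leVge.
have ss : sorted (fun x y => y <= x) s' := sort_sorted_in tot sreal.
have [i isz ti] : exists2 i, (0 < i < size s')%N & t = s'`_i.
  move: ts; clearbody s'; case: s' {ss rs'} => // a s' /(nthP 0) [i isz <-].
  by exists i.+1.
have tr : transitive (fun x y : algC => y <= x) by move=> x y z; move=> h1 h2; apply: le_trans h2 h1.
have rf : reflexive (fun x y : algC => y <= x) by move=> x; apply: lexx.
have mono := sorted_leq_nth tr rf 0 ss.
have t1 : t <= s'`_1 by rewrite ti; apply: mono; rewrite ?inE; case/andP: isz => //; apply: leq_ltn_trans.
have t2 : last 0 s' <= t.
  case/andP: isz => i0 isz.
  rewrite ti -nth_last; apply: mono; rewrite ?inE.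
  - exact: isz.
  - by rewrite ltn_predL (leq_trans _ isz).
  - by rewrite -ltnS (ltn_predK isz).
have rin k : s'`_k \is Num.real.
  case: (ltnP k (size s')) => ks; last by rewrite nth_default.
  by apply: (allP rs'); rewrite mem_nth.
have lin : last 0 s' \is Num.real by rewrite -nth_last.
have ti' : t \is Num.real by rewrite ti.
rewrite comparable_le_max ?real_comparable //; case: (real_leP ti' (real0 _)) => t0.
  apply/orP; right; rewrite ler0_norm // -normrN (le_trans _ (real_ler_norm _)) ?lerN2 ?rpredN //.
by rewrite (gtr0_norm t0) (le_trans t1) // real_ler_norm.
Qed.

Definition conj_dot n (u v : 'rV[algC]_n) := (u *m v ^t*) 0 0.

Lemma conj_dotE n (u v : 'rV[algC]_n) : conj_dot u v = \sum_i u 0 i * (v 0 i)^*.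
Proof. by rewrite /conj_dot mxE; apply: eq_bigr => i _; rewrite !mxE. Qed.

Lemma adj_mx_tr n (e : rel 'I_n) : symmetric e -> (adj_mx e) ^t* = adj_mx e.
Proof. by move=> es; apply/matrixP => i j; rewrite !mxE es conjC_nat. Qed.

Definition indic n (X : {set 'I_n}) : 'rV[algC]_n := \row_i (i \in X)%:R.

Lemma conj_dot_indic n (X Y : {set 'I_n}) : conj_dot (indic X) (indic Y) = #|X :&: Y|%:R.
Proof.
rewrite conj_dotE -sum1_card natr_sum [RHS]big_mkcond; apply: eq_bigr => i _.
by rewrite !mxE conjC_nat inE; do 2![case: (_ \in _)]; rewrite ?mul0r ?mulr0 ?mulr1.
Qed.

Lemma conj_dot_adj n (e : rel 'I_n) (X Z : {set 'I_n}) : symmetric e ->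
  conj_dot (indic X *m adj_mx e) (indic Z) = (\sum_(v in X) degin e Z v)%:R.
Proof.
move=> es; rewrite sum_degin_sym // conj_dotE natr_sum [RHS]big_mkcond; apply: eq_bigr => i _.
rewrite !mxE conjC_nat; case: (i \in Z); rewrite ?mulr0 // mulr1 deginE natr_sum [RHS]big_mkcond.
by apply: eq_bigr => j _; rewrite !mxE es; case: (j \in X); rewrite ?mul1r ?mul0r.
Qed.

Lemma indic_regular n (e : rel 'I_n) d : symmetric e -> regular_of e d ->
  indic setT *m adj_mx e = d%:R *: indic setT.
Proof.
move=> es er; apply/matrixP => i j; rewrite !mxE in_setT mulr1 -(er j) /degree -sum1_card natr_sum.
rewrite [RHS]big_mkcond; apply: eq_bigr => k _; rewrite !mxE in_setT mul1r inE es.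
by case: (e j k).
Qed.

(** [lambdaG] bounds all eigenvalues except the head of the sorted list, which sits at some index
    [i0]. The all-ones vector is an eigenvector for [d], and the other eigenvalues have modulus at
    most [d / 12 < d]; so in the spectral basis it is supported on [i0], and the exceptional
    eigenvalue is [d]. *)
Theorem expander_mixing n d lam (e : rel 'I_n) : (0 < n)%N -> (0 < d)%N ->
  nd_lambda_graph d lam e -> lam <= d%:R / 12%:R -> mixing e d.
Proof.
move=> n0 d0 [[es _] [er lamG]] lamd X Z; have {}es : symmetric e by move=> u v; apply: es.
set A := adj_mx e; have At : A ^t* = A := adj_mx_tr es.
have /orthomx_spectralP : A \is normalmx by apply/normalmxP; rewrite At.
set P := spectralmx A; set mu := spectral_diag A => EA.
have uP : P \is unitarymx := spectral_unitarymx A.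
have mur i : mu 0 i \is Num.real.
  have /mxOverP : mu \is a mxOver Num.real.
    by apply: hermitian_spectral_diag_real; apply/is_hermitianmxP; rewrite expr0 scale1r; apply/esym.
  exact.
have iP : invmx P = P ^t* := invmx_unitary uP.
have PP : P ^t* *m P = 1%:M by rewrite -iP mulVmx ?unitarymx_unit.
have tK (M : 'M[algC]_n) : M ^t* ^t* = M by apply: trmxCK.
have dotP (u v : 'rV_n) : conj_dot (u *m P ^t*) (v *m P ^t*) = conj_dot u v.
  by rewrite /conj_dot trmx_mul map_mxM /= tK mulmxA -(mulmxA u) PP mulmx1.
have dotA (u v : 'rV_n) : conj_dot (u *m A) v =
    \sum_i mu 0 i * ((u *m P ^t*) 0 i * ((v *m P ^t*) 0 i)^*).
  rewrite EA iP -dotP conj_dotE; apply: eq_bigr => i _; rewrite !mulmxA.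
  rewrite -(mulmxA _ P) -iP mulmxV ?unitarymx_unit // mulmx1 mul_mx_diag mxE.
  by rewrite [RHS]mulrA (mulrC (mu 0 i)).
pose y (X : {set 'I_n}) := indic X *m P ^t*.
pose j := y setT.
have yj i : mu 0 i * j 0 i = d%:R * j 0 i.
  have : (indic setT *m A *m P ^t*) = d%:R *: j by rewrite (indic_regular es er) scalemxAl.
  rewrite EA iP !mulmxA -(mulmxA _ P) -iP mulmxV ?unitarymx_unit // mulmx1 iP.
  by move/matrixP => /(_ 0 i); rewrite mul_mx_diag !mxE mulrC.
have d12 : (d%:R / 12%:R : algC) < d%:R.
  by rewrite ltr_pdivrMr ?ltr0n // -natrM ltr_nat; move: d0; clear; lia.
have [i0 mu_i0] : exists i0, forall i, i != i0 -> `|mu 0 i| <= d%:R / 12%:R.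
  have := perm_eigenvalues mu uP; rewrite -EA.
  have : forall t, t \in behead (eigenvalues A) -> `|t| <= d%:R / 12%:R.
    move=> t ts; apply: le_trans (le_trans lamG lamd); apply: norm_behead_sort_le ts.
    have := perm_eigenvalues mu uP; rewrite -EA perm_sort => /perm_all ->.
    by apply/allP => _ /mapP [i _ ->]; apply: mur.
  case: (eigenvalues A) => [_ /perm_size|s0 s sle pm].
    by rewrite size_map size_enum_ord /= => n0'; rewrite -n0' in n0.
  have /mapP [i0 _ Ei0] : s0 \in [seq mu 0 i | i <- enum 'I_n] by rewrite -(perm_mem pm) mem_head.
  exists i0 => i ii0; apply: sle => /=.
  have pi0 : perm_eq (enum 'I_n) (i0 :: rem i0 (enum 'I_n)) by apply: perm_to_rem; rewrite mem_enum.
  have := perm_trans pm (perm_map (fun i => mu 0 i) pi0); rewrite /= -Ei0 perm_cons => /perm_mem ->.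
  by apply: map_f; rewrite (mem_rem_uniq i0 (enum_uniq _)) !inE ii0 mem_enum.
have j0 i : i != i0 -> j 0 i = 0.
  move=> ii0; have /eqP := yj i; rewrite -subr_eq0 -mulrBl mulf_eq0 => /orP [|/eqP //].
  rewrite subr_eq0 => /eqP mud; have := mu_i0 i ii0.
  by rewrite mud normr_nat => /le_lt_trans /(_ d12); rewrite ltxx.
have dotj (W : {set 'I_n}) : y W 0 i0 * (j 0 i0)^* = #|W|%:R.
  rewrite -[W in RHS]setIT -conj_dot_indic -dotP conj_dotE (bigD1 i0) //= big1 ?addr0 // => i ii0.
  by rewrite -/(j) j0 // conjC0 mulr0.
have dotjC (W : {set 'I_n}) : j 0 i0 * (y W 0 i0)^* = #|W|%:R.
  by have := congr1 Num.conj (dotj W); rewrite rmorphM /= conjCK conjC_nat mulrC.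
have nzj : (j 0 i0 * (j 0 i0)^*) = n%:R by rewrite dotj cardsT card_ord.
have mud : mu 0 i0 = d%:R.
  have jn0 : j 0 i0 != 0.
    by apply: contraTneq n0 => z; move: nzj; rewrite z mul0r => /eqP; rewrite eq_sym pnatr_eq0 -leqn0 leqNgt.
  by apply: (mulIf jn0).
have sqn (W : {set 'I_n}) : \sum_i `|y W 0 i| ^+ 2 = #|W|%:R.
  rewrite -[W in RHS]setIid -conj_dot_indic -dotP conj_dotE.
  by apply: eq_bigr => i _; rewrite normCK.
have main : n%:R * (\sum_(v in X) degin e Z v)%:R <=
   d%:R * (#|X|%:R * #|Z|%:R) + n%:R * (d%:R / 12%:R * ((#|X|%:R + #|Z|%:R) / 2%:R)) :> algC.
  have nE : n%:R * (\sum_(v in X) degin e Z v)%:R = d%:R * (#|X|%:R * #|Z|%:R) +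
      n%:R * (\sum_(i | i != i0) mu 0 i * (y X 0 i * (y Z 0 i)^*)) :> algC.
    rewrite -conj_dot_adj // dotA (bigD1 i0) //= mulrDr mud; congr (_ + _).
    by rewrite -(dotj X) -(dotjC Z) -nzj; ring.
  have nC0 : (n%:R : algC) != 0 by rewrite pnatr_eq0 -lt0n.
  (* By [nE] this is a difference of naturals divided by [n]; being real is what allows bounding it
     by its modulus. *)
  have Rreal : \sum_(i | i != i0) mu 0 i * (y X 0 i * (y Z 0 i)^*) \is Num.real.
    rewrite -(mulKf nC0 (\sum_(i | _) _)) -(addKr (d%:R * (#|X|%:R * #|Z|%:R)) (n%:R * _)) -nE.
    by rewrite rpredM ?rpredV ?rpredD ?rpredN ?rpredM ?realn.
  rewrite nE lerD2l ler_wpM2l ?ler0n // (le_trans (real_ler_norm _)) //.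
  rewrite (le_trans (ler_norm_sum _ _ _)) // -!sqn -big_split /= mulr_suml mulr_sumr.
  rewrite [in leRHS](bigD1 i0) //= ler_wpDl //.
    by rewrite !mulr_ge0 ?invr_ge0 ?addr_ge0 ?exprn_ge0 ?ler0n.
  apply: ler_sum => i ii0; rewrite !normrM norm_conjC ler_pM ?mulr_ge0 ?mu_i0 //.
  rewrite ler_pdivlMr ?ltr0n // -subr_ge0.
  have -> : `|y X 0 i| ^+ 2 + `|y Z 0 i| ^+ 2 - `|y X 0 i| * `|y Z 0 i| * 2%:R =
     (`|y X 0 i| - `|y Z 0 i|) ^+ 2 by ring.
  by rewrite real_exprn_even_ge0 // rpredB ?normr_real.
rewrite -(ler_nat algC) natrD !natrM natrD card_ord.
have {}main := ler_wpM2l (ler0n algC 24) main.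
rewrite -mulrA (le_trans main) // le_eqVlt; apply/orP; left; apply/eqP; field=> //.
Qed.
End Spectral.

(** * The asymmetric local lemma *)

Section LocalLemma.
Set Implicit Arguments. Unset Strict Implicit. Unset Printing Implicit Defensive.
Variables (T L I : finType).
Local Notation Omega := {ffun T -> L}.
Implicit Types (B C : {set Omega}) (D : {set T}).

Definition determined B D := forall w w' : Omega,
  (forall t, t \in D -> w t = w' t) -> (w \in B) = (w' \in B).

Lemma determinedS B D D' : D \subset D' -> determined B D -> determined B D'.
Proof. by move=> DD dB w w' ww; apply: dB => t /(subsetP DD); apply: ww. Qed.

(** [phi] exchanges two samples outside [D]; this involution maps [B :&: C] times [Omega] onto [B]
    times [C]. *)
Lemma independent B C D D' : determined B D -> determined C D' -> [disjoint D & D'] ->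
  (#|B :&: C| * #|Omega| = #|B| * #|C|)%N.
Proof.
move=> dB dC dis.
pose mix (w w' : Omega) : Omega := [ffun t => if t \in D then w t else w' t].
pose phi (u : Omega * Omega) := (mix u.1 u.2, mix u.2 u.1).
have phiK : involutive phi.
  by move=> [w w']; congr (_, _); apply/ffunP => t; rewrite !ffunE; case: ifP => //= ->.
rewrite -cardsT -!cardsX -(card_imset _ (inv_inj phiK)); congr #|pred_of_set _|.
apply/setP => -[w w']; apply/imsetP/setXP => [[[u u'] /setXP [ /setIP [uB uC] _] [-> ->]]|[wB wC]].
  split; first by rewrite (dB _ u) // => t tD; rewrite ffunE tD.
  by rewrite (dC _ u) // => t tD; rewrite ffunE (disjointFl dis tD).
exists (phi (w, w')); last by rewrite phiK.
rewrite !inE andbT; apply/andP; split; first by rewrite (dB _ w) // => t tD; rewrite ffunE tD.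
by rewrite (dC _ w') // => t tD; rewrite ffunE (disjointFl dis tD).
Qed.

Variables (A : I -> {set Omega}) (D : I -> {set T}) (x : I -> rat).
Hypothesis dA : forall i, determined (A i) (D i).
Hypothesis x01 : forall i, 0 <= x i < 1.
Local Notation touching i := [set j | (j != i) && ~~ [disjoint D i & D j]].
Hypothesis probA : forall i,
  #|A i|%:R <= x i * \prod_(j in touching i) (1 - x j) * #|Omega|%:R.

Definition avoid (S : {set I}) : {set Omega} := \bigcap_(j in S) ~: A j.

Lemma avoid_determined (S : {set I}) (F : {set T}) : (forall j, j \in S -> D j \subset F) ->
  determined (avoid S) F.
Proof.
move=> SF w w' ww; apply/bigcapP/bigcapP => h j jS; have := h j jS; rewrite !inE.
  by rewrite (determinedS (SF j jS) (@dA j) ww).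
by rewrite (determinedS (SF j jS) (@dA j) ww).
Qed.

Lemma avoidU1 j S : #|avoid (j |: S)|%:R = #|avoid S|%:R - #|A j :&: avoid S|%:R :> rat.
Proof.
have -> : avoid (j |: S) = avoid S :\: A j.
  apply/setP => w; rewrite inE; apply/bigcapP/andP => [h|[wj /bigcapP h] k].
    split; first by have := h j; rewrite !inE eqxx => /(_ isT).
    by apply/bigcapP => k kS; apply: h; rewrite inE kS orbT.
  by rewrite !inE => /orP [/eqP ->|/h] //; rewrite inE.
by rewrite -(cardsID (A j) (avoid S)) natrD (setIC (A j)) addrC addKr.
Qed.

Lemma avoid_subset (S S' : {set I}) : S \subset S' -> avoid S' \subset avoid S.
Proof. by move=> SS; apply/subsetP => w /bigcapP h; apply/bigcapP => j /(subsetP SS); apply: h. Qed.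

(** The chain rule for conditional probabilities, with denominators cleared so that conditioning on
    an empty event is harmless. The bound for single events is assumed below size [m] only; the
    induction in [avoid_conditional] supplies it. *)
Lemma avoid_prod m (U S : {set I}) :
  (forall (S' : {set I}) j, (#|S'| < m)%N -> #|A j :&: avoid S'|%:R <= x j * #|avoid S'|%:R) ->
  [disjoint U & S] -> (#|U :|: S| <= m)%N ->
  \prod_(j in U) (1 - x j) * #|avoid S|%:R <= #|avoid (U :|: S)|%:R.
Proof.
move=> IH; elim: {U}#|U| {-2}U (erefl #|U|) => [|k IHk] U cU dis cm.
  by move/eqP: cU; rewrite cards_eq0 => /eqP ->; rewrite big_set0 mul1r set0U.
have [j jU] : exists j, j \in U by apply/set0Pn; rewrite -card_gt0 cU.
rewrite (big_setD1 j jU) /= -(setD1K jU) -setUA avoidU1.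
have jW : j \notin (U :\ j) :|: S by rewrite !inE eqxx /= (disjointFr dis jU).
have cW : (#|(U :\ j) :|: S| < m)%N.
  by apply: leq_trans cm; rewrite -[in X in (_ <= X)%N](setD1K jU) -setUA cardsU1 jW.
have disW : [disjoint U :\ j & S] by apply: disjointWl dis; apply: subsetDl.
have cUj : #|U :\ j| = k by move: cU; rewrite (cardsD1 j) jU => -[].
have := IHk _ cUj disW (ltnW cW); have := IH _ j cW; have /andP [_ x1] := x01 j.
rewrite setU1K ?inE ?eqxx // -mulrA => h1 h2.
apply: le_trans (_ : (1 - x j) * #|avoid ((U :\ j) :|: S)|%:R <= _).
  by apply: ler_wpM2l h2; rewrite subr_ge0 ltW.
by rewrite mulrBl mul1r lerD2l lerN2.
Qed.

Lemma avoid_conditional m (S : {set I}) i : (#|S| < m)%N ->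
  #|A i :&: avoid S|%:R <= x i * #|avoid S|%:R.
Proof.
elim: m S i => // m IHm S i cS.
have [iS|iS] := boolP (i \in S).
  rewrite (_ : A i :&: avoid S = set0) ?cards0 ?mulr_ge0 ?ler0n //; first by have /andP [] := x01 i.
  apply/eqP; rewrite setI_eq0; apply/pred0Pn => -[w /andP [/= wA /bigcapP /(_ i iS)]].
  by rewrite inE wA.
(* [U] collects the events of [S] that may interact with [A i]; avoiding [S2] is independent of
   [A i]. *)
pose U := S :&: touching i; pose S2 := S :\: touching i.
have ES : U :|: S2 = S by rewrite setID.
have dis : [disjoint U & S2].
  by rewrite -setI_eq0; apply/eqP/setP => j; rewrite !inE; case: (j \in S); case: (j != i); case: [disjoint _ & _].
have xi0 : 0 <= x i by have /andP [] := x01 i.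
have h1 : \prod_(j in touching i) (1 - x j) * #|avoid S2|%:R <= #|avoid S|%:R.
  rewrite -[in leRHS]ES; apply: le_trans (avoid_prod IHm dis _); last by rewrite ES.
  apply: ler_wpM2r; first exact: ler0n.
  rewrite (big_setID S) /= setIC -/U -[leRHS]mulr1; apply: ler_wpM2l.
    by apply: prodr_ge0 => j _; rewrite subr_ge0; have /andP [_ /ltW] := x01 j.
  by apply: prodr_ile1 => j _; have /andP [h1 h2] := x01 j; rewrite subr_ge0 ltW //= gerBl.
have h2 : #|A i :&: avoid S|%:R <= #|A i :&: avoid S2|%:R :> rat.
  by rewrite ler_nat subset_leq_card // setIS // avoid_subset // subsetDl.
(* [Omega] may be empty, and independence is applied by cancelling its size. *)
have [w0 _|om0] := pickP [pred w : Omega | true]; last first.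
  by rewrite (_ : A i :&: _ = set0) ?cards0 ?mulr_ge0 ?ler0n //; apply/setP => w; have := om0 w.
have om1 : 0 < #|Omega|%:R :> rat by rewrite ltr0n (cardD1 w0).
have ind : (#|A i :&: avoid S2| * #|Omega| = #|A i| * #|avoid S2|)%N.
  have sub j : j \in S2 -> D j \subset ~: D i.
    rewrite !inE negb_and !negbK => /andP [/orP [/eqP ->|dj] jS]; first by rewrite jS in iS.
    by rewrite -disjoints_subset disjoint_sym.
  apply: (@independent _ _ (D i) (~: D i)); first exact: (@dA i).
    exact: (@avoid_determined _ _ sub).
  by rewrite -setI_eq0 setICr.
rewrite (le_trans h2) // -(ler_pM2r om1) -natrM ind natrM.
rewrite (le_trans (ler_wpM2r (ler0n _ _) (probA i))) //.
rewrite mulrAC ler_wpM2r // -mulrA ler_wpM2l //.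
Qed.

Theorem local_lemma : (0 < #|Omega|)%N -> exists w : Omega, forall i, w \notin A i.
Proof.
move=> om0; have := @avoid_prod #|I|.+1 setT set0.
rewrite setU0 -setI_eq0 setI0 eqxx => /(_ _ isT) h.
have {h} : 0 < #|avoid setT|%:R :> rat.
  apply: lt_le_trans (h _ _); last by rewrite cardsT.
    rewrite mulr_gt0 ?prodr_gt0 // => [j _|].
      by rewrite subr_gt0; have /andP [] := x01 j.
    by rewrite /avoid big_set0 cardsT ltr0n.
  by move=> S j _; apply: (@avoid_conditional #|S|.+1).
rewrite ltr0n card_gt0 => /set0Pn [w /bigcapP h]; exists w => i.
by have := h i (in_setT i); rewrite inE.
Qed.
End LocalLemma.

(** * Random labellings opposite on matched vertices *)

Section Labelings.
Set Implicit Arguments. Unset Strict Implicit. Unset Printing Implicit Defensive.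

Lemma bernoulli (x : rat) k : -1 <= x -> 1 + k%:R * x <= (1 + x) ^+ k.
Proof.
move=> x1; elim: k => [|k IH]; first by rewrite mul0r addr0 expr0.
rewrite exprS; apply: le_trans (ler_wpM2l _ IH); last by lra.
rewrite -natr1; suff : 0 <= k%:R * (x * x) by lra.
by rewrite mulr_ge0 ?ler0n // -expr2 sqr_ge0.
Qed.

Lemma exp_one_sub_ge (e k : nat) : (4 * k <= 2 ^ e)%N -> (3%:R / 4%:R : rat) <= (1 - 2%:R ^- e) ^+ k.
Proof.
move=> ke; have p0 : (0 : rat) < 2%:R ^+ e by rewrite exprn_gt0.
have le1 : 2%:R ^- e <= 1 :> rat by rewrite invf_le1 // exprn_ege1.
apply: le_trans (bernoulli k _); last by rewrite lerN2.
rewrite -(ler_nat rat) natrM natrX in ke.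
have : k%:R * 2%:R ^- e <= 1 / 4%:R :> rat by rewrite ler_pdivrMr //; move: ke; clear; lra.
by move: le1; clear; lra.
Qed.

(** Bernoulli's inequality gives [(1 - 2^-e)^(2^(e-1)) >= 1/2], to be raised to the power [Y]. *)
Lemma exp_one_sub_ge2 (e k Y : nat) : (0 < e)%N -> (2 * k <= 2 ^ e * Y)%N ->
  2%:R ^- Y <= (1 - 2%:R ^- e) ^+ k :> rat.
Proof.
case: e => // e _ kY; have p0 : (0 : rat) < 2%:R ^+ e.+1 by rewrite exprn_gt0.
have le1 : 2%:R ^- e.+1 <= 1 :> rat by rewrite invf_le1 // exprn_ege1.
have x0 : 0 <= 2%:R ^- e.+1 :> rat by rewrite invr_ge0 ltW.
have {}kY : (k <= 2 ^ e * Y)%N by move: kY; rewrite expnS -mulnA leq_mul2l.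
apply: (@le_trans _ _ ((1 - 2%:R ^- e.+1) ^+ (2 ^ e * Y))); last first.
  by apply: ler_wiXn2l => //; rewrite ?subr_ge0 // gerBl.
rewrite exprM -exprVn lerXn2r ?nnegrE ?invr_ge0 ?ler0n ?exprn_ge0 ?subr_ge0 //.
apply: le_trans (bernoulli _ _); last by rewrite lerN2.
have -> : (2 ^ e)%:R * - 2%:R ^- e.+1 = - (1 / 2%:R) :> rat.
  by rewrite natrX exprS; field; rewrite expf_neq0.
by rewrite [leRHS](_ : _ = 2%:R^-1) //; field.
Qed.

Variables (V L : finType) (pi : V -> V) (comp : L -> L).
Hypotheses (piK : involutive pi) (pi_fpf : forall v, pi v != v) (compK : involutive comp).
Local Notation Omega := {ffun V -> L}.

Definition lead v := (enum_rank v < enum_rank (pi v))%N.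
Definition rep v := if lead v then v else pi v.
(* Only the coordinates of [w] at lead vertices matter: the label of the other vertex of a pair is
   forced to be the complement. *)
Definition labeling (w : Omega) v := if lead v then w v else comp (w (pi v)).

Lemma lead_pi v : lead (pi v) = ~~ lead v.
Proof.
rewrite /lead piK -leqNgt ltn_neqAle andb_idl // => _; apply: contra (pi_fpf v).
by move/eqP/ord_inj/enum_rank_inj => E; apply/eqP.
Qed.

Lemma labeling_pi w v : labeling w (pi v) = comp (labeling w v).
Proof. by rewrite /labeling lead_pi piK; case: (lead v) => //=; rewrite compK. Qed.

Lemma labeling_eq (w w' : Omega) v : w (rep v) = w' (rep v) -> labeling w v = labeling w' v.
Proof. by rewrite /rep /labeling; case: ifP => _ ->. Qed.

Lemma rep_eq u v : rep u = rep v -> v = u \/ v = pi u.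
Proof. by rewrite /rep; do 2!case: ifP => _; move=> E; [left|right|right|left]; rewrite ?E ?piK // -?E ?piK //; apply: (inv_inj piK). Qed.

(** The factor 2 arises because a representative stands for both vertices of its pair. *)
Lemma touching_count (J : finType) (W : J -> {set V}) (U : {set V}) K :
  (forall v, #|[set j | v \in W j]| <= K)%N ->
  (#|[set j | ~~ [disjoint rep @: U & rep @: W j]]| <= 2 * #|U| * K)%N.
Proof.
move=> WK; pose F u := [set j | u \in W j] :|: [set j | pi u \in W j].
apply: (@leq_trans #|\bigcup_(u in U) F u|).
  apply/subset_leq_card/subsetP => j; rewrite inE => /pred0Pn [t /andP [/= /imsetP [u uU ->] /imsetP [v vW ruv]]].
  by apply/bigcupP; exists u => //; rewrite !inE; case: (rep_eq ruv) => <-; rewrite vW ?orbT.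
apply: (@leq_trans (\sum_(u in U) (K + K))); last by rewrite sum_nat_const -[in leqRHS]mulnA mulnCA mul2n -addnn.
apply: (big_ind2 (fun (S : {set J}) k => #|S| <= k)%N) => [|S a S' b Sa Sb|u _]; first by rewrite cards0.
  by rewrite (leq_trans (leq_card_setU _ _)) // leq_add.
by rewrite (leq_trans (leq_card_setU _ _)) // leq_add.
Qed.

End Labelings.

(** * A Chernoff bound for labels that are opposite on matched vertices *)

Section Chernoff.
Set Implicit Arguments. Unset Strict Implicit. Unset Printing Implicit Defensive.
Variables (V L : finType) (pi : V -> V) (comp : L -> L).
Hypotheses (piK : involutive pi) (pi_fpf : forall v, pi v != v) (compK : involutive comp).
Local Notation Omega := {ffun V -> L}.
Local Notation lab := (labeling pi comp).
Local Notation lead := (lead pi).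

Variables (S : {set V}) (b : L -> bool) (M N : nat).
Hypothesis b_comp : forall l, b (comp l) = ~~ b l.
Hypotheses (N0 : (0 < N)%N) (cS : (#|S| <= M * (2 * N) ^ 2)%N).
Local Notation s := ((2 * N)%:R^-1 : rat).

Let s0 : 0 <= s. Proof. by rewrite invr_ge0 ler0n. Qed.
Let s1 : s <= 1. Proof. by rewrite invf_le1 ?ltr0n ?ler1n muln_gt0. Qed.

Let sg (l : L) : rat := if b l then s else - s.

Let sg_ge l : -1 <= sg l.
Proof.
rewrite /sg; case: ifP => _; first by apply: (le_trans _ s0); rewrite lerN10.
by rewrite lerN2 s1.
Qed.

Let sg_comp l : sg (comp l) = - sg l.
Proof. by rewrite /sg b_comp; case: (b l); rewrite ?opprK. Qed.

(** A rational substitute for the exponential moment: its mean is at most 1, and Markov's inequality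
    is applied to it. *)
Let weight (w : Omega) := \prod_(u in S) (1 + sg (lab w u)).

Let h t l : rat := if lead t then
  (if t \in S then 1 + sg l else 1) * (if pi t \in S then 1 - sg l else 1) else 1.

Lemma weightE w : weight w = \prod_t h t (w t).
Proof.
rewrite /weight big_mkcond (bigID lead) /= [RHS](bigID lead) /=.
rewrite [X in _ = _ * X]big1 ?mulr1 => [|t /negPf lt]; last by rewrite /h lt.
rewrite [X in _ * X](reindex_inj (inv_inj piK)) /=.
rewrite [X in _ * X](eq_bigl lead) => [|t]; last by rewrite lead_pi // negbK.
rewrite -big_split; apply: eq_bigr => t lt; rewrite /h lt /= labeling_pi // sg_comp.
by rewrite /labeling lt.
Qed.

(* The factors of a matched pair multiply to [1 - s^2], so pairs inside [S] only help. *)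
Lemma sum_h t : \sum_l h t l <= #|L|%:R.
Proof.
(* Reindexing the second copy by [comp] cancels the terms linear in [sg l]. *)
suff : \sum_l h t l + \sum_l h t l <= #|L|%:R + #|L|%:R :> rat by lra.
rewrite [X in _ + X](reindex_inj (inv_inj compK)) /= -!big_split /=.
rewrite -natrD -sum1_card -big_split natr_sum; apply: ler_sum => l _ /=.
rewrite /h sg_comp; move: (sg l) (sg_ge l) => x x1; case: (lead t); last by rewrite natrD.
have := sqr_ge0 x; rewrite expr2 => x2; rewrite natrD.
by do 2!case: ifP => _; lra.
Qed.

Lemma sum_weight : \sum_w weight w <= #|Omega|%:R.
Proof.
rewrite (eq_bigr _ (fun w _ => weightE w)) -bigA_distr_bigA /= card_ffun natrX.
rewrite -prodr_const; apply: ler_prod => t _; rewrite sum_h andbT.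
apply: sumr_ge0 => l _; rewrite /h; case: (lead t) => //.
have := sg_ge l; have := sg_ge (comp l); rewrite sg_comp => h1 h2.
by rewrite mulr_ge0 //; case: ifP => _ //; lra.
Qed.

Definition agree (w : Omega) := #|[set u in S | b (lab w u)]|.
Definition disagree (w : Omega) := #|[set u in S | ~~ b (lab w u)]|.

Lemma agree_disagree w : (agree w + disagree w = #|S|)%N.
Proof.
rewrite -(cardsID [set u | b (lab w u)] S); congr (_ + _)%N; apply: eq_card => u; rewrite !inE //.
by rewrite andbC.
Qed.

Lemma weight_pow w : weight w = (1 + s) ^+ agree w * (1 - s) ^+ disagree w.
Proof.
rewrite /weight (bigID (fun u => b (lab w u))) /= -!prodr_const; congr (_ * _).
  by apply: eq_big => [u|u /andP [_ bu]]; rewrite ?inE // /sg bu.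
by apply: eq_big => [u|u /andP [_ /negPf bu]]; rewrite ?inE // /sg bu.
Qed.

(** [disagree w] is at most half the bound on [#|S|], so pairing each disagreement with an agreement
    leaves a factor [(1 - s ^ 2) ^ disagree w >= 2^-M]. The [3 * M * (2 * N)] further agreements
    contribute [2 ^ (3 * M)], since [(1 + s) ^ (2 * N) >= 2]. *)
Lemma weight_large w : (disagree w + 3 * M * (2 * N) <= agree w)%N -> 2%:R ^+ (2 * M) <= weight w.
Proof.
move=> da; rewrite weight_pow.
have [k Ek] : exists k, agree w = (disagree w + 3 * M * (2 * N) + k)%N.
  by exists (agree w - (disagree w + 3 * M * (2 * N)))%N; rewrite subnKC.
have qle : (disagree w <= 2 * N ^ 2 * M)%N.
  by have := agree_disagree w; move: cS; rewrite Ek expnMn; clear; lia.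
have nz : (2 * N)%:R != 0 :> rat by rewrite pnatr_eq0 muln_eq0 -lt0n.
have h1 : 2%:R <= (1 + s) ^+ (2 * N) :> rat.
  apply: le_trans (bernoulli _ _); last by apply: le_trans s0; rewrite lerN10.
  by rewrite mulfV.
have h2 : 2%:R^-1 <= (1 - s ^+ 2) ^+ (2 * N ^ 2) :> rat.
  apply: le_trans (bernoulli _ _); last first.
    by rewrite lerN2 exprn_ile1.
  have -> : (2 * N ^ 2)%:R * - s ^+ 2 = - 2%:R^-1 :> rat.
    by rewrite natrM natrX natrM; field; rewrite pnatr_eq0 -lt0n.
  by lra.
have -> : (1 + s) ^+ agree w * (1 - s) ^+ disagree w =
    (1 - s ^+ 2) ^+ disagree w * ((1 + s) ^+ (2 * N)) ^+ (3 * M) * (1 + s) ^+ k.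
  have -> : 1 - s ^+ 2 = (1 + s) * (1 - s) by ring.
  rewrite Ek exprMn 2!exprD -exprM (mulnC (2 * N)%N).
  by rewrite -!mulrA; congr (_ * _); rewrite mulrA mulrC.
have sle : s ^+ 2 <= 1 by rewrite exprn_ile1.
have h3 : 2%:R ^- M <= (1 - s ^+ 2) ^+ disagree w.
  apply: (@le_trans _ _ ((1 - s ^+ 2) ^+ (2 * N ^ 2 * M))).
    by rewrite exprM -exprVn lerXn2r ?nnegrE ?invr_ge0 ?exprn_ge0 ?subr_ge0.
  by apply: ler_wiXn2l; rewrite ?subr_ge0 // gerBl exprn_ge0.
have h4 : 2%:R ^+ (3 * M) <= ((1 + s) ^+ (2 * N)) ^+ (3 * M).
  by rewrite lerXn2r ?nnegrE ?exprn_ge0 ?addr_ge0.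
have h5 : 1 <= (1 + s) ^+ k by rewrite exprn_ege1 // lerDl.
have -> : 2%:R ^+ (2 * M) = 2%:R ^- M * 2%:R ^+ (3 * M) * 1 :> rat.
  by rewrite (_ : 3 * M = M + 2 * M)%N ?exprD ?mulr1 ?mulKf ?expf_neq0 //; move: M; clear; lia.
apply: ler_pM => //; first by rewrite mulr_ge0 ?invr_ge0 ?exprn_ge0.
by apply: ler_pM => //; rewrite ?invr_ge0 ?exprn_ge0.
Qed.

Lemma chernoff :
  (#|[set w | (disagree w + 3 * M * (2 * N) <= agree w)%N]| * 2 ^ (2 * M) <= #|Omega|)%N.
Proof.
rewrite -(ler_nat rat); apply: le_trans sum_weight; rewrite natrM natrX -sum1_card natr_sum mulr_suml.
rewrite [leRHS](bigID (fun w => w \in [set w | (disagree w + 3 * M * (2 * N) <= agree w)%N])) /=.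
rewrite -[leLHS]addr0 lerD //.
  by apply: ler_sum => w; rewrite inE mul1r => /weight_large.
apply: sumr_ge0 => w _; apply: prodr_ge0 => u _.
by rewrite addrC -lerBlDr sub0r.
Qed.
End Chernoff.

(** * The local lemma for two classes of events *)

Section TwoClasses.
Set Implicit Arguments. Unset Strict Implicit. Unset Printing Implicit Defensive.
Variables (V L : finType) (pi : V -> V) (comp : L -> L).
Hypothesis piK : involutive pi.
Local Notation Omega := {ffun V -> L}.
Local Notation lab := (labeling pi comp).
Local Notation rep := (rep pi).

Definition depends (A : {set Omega}) (U : {set V}) := forall w w' : Omega,
  (forall v, v \in U -> lab w v = lab w' v) -> (w \in A) = (w' \in A).

Lemma depends_determined A U : depends A U -> determined A (rep @: U).
Proof.
by move=> dA w w' ww; apply: dA => v vU; apply: labeling_eq => //; apply/ww/imset_f.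
Qed.

Variables (I1 I2 : finType) (A1 : I1 -> {set Omega}) (A2 : I2 -> {set Omega}).
Variables (U1 : I1 -> {set V}) (U2 : I2 -> {set V}) (m1 K1 m2 K2 e1 e2 Y : nat).
Hypothesis dep1 : forall i, depends (A1 i) (U1 i).
Hypothesis dep2 : forall i, depends (A2 i) (U2 i).
Hypothesis cU1 : forall i, (#|U1 i| <= m1)%N.
Hypothesis cU2 : forall i, (#|U2 i| <= m2)%N.
Hypothesis mult1 : forall v, (#|[set i | v \in U1 i]| <= K1)%N.
Hypothesis mult2 : forall v, (#|[set i | v \in U2 i]| <= K2)%N.
Hypotheses (e10 : (0 < e1)%N) (e20 : (0 < e2)%N).
Hypothesis H11 : (8 * m1 * K1 <= 2 ^ e1)%N.
Hypothesis H12 : (8 * m1 * K2 <= 2 ^ e2)%N.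
Hypothesis H22 : (8 * m2 * K2 <= 2 ^ e2)%N.
Hypothesis H21 : (4 * m2 * K1 <= 2 ^ e1 * Y)%N.
Hypothesis P1 : forall i, (#|A1 i| * 2 ^ (e1 + 1) <= #|Omega|)%N.
Hypothesis P2 : forall i, (#|A2 i| * 2 ^ (e2 + 1 + Y) <= #|Omega|)%N.

Let A (i : I1 + I2) := match i with inl j => A1 j | inr j => A2 j end.
Let U (i : I1 + I2) := match i with inl j => U1 j | inr j => U2 j end.
Let x (i : I1 + I2) : rat := match i with inl _ => 2%:R ^- e1 | inr _ => 2%:R ^- e2 end.
Let touching i := [set j | (j != i) && ~~ [disjoint rep @: U i & rep @: U j]].

Let half_unit e : (0 < e)%N -> 0 <= (2%:R ^- e : rat) < 1.
Proof.
by move=> e0; rewrite invr_ge0 exprn_ge0 //= invf_lt1 ?exprn_gt0 // exprn_egt1 // -lt0n.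
Qed.

Let ratio_le a E om : (a * 2 ^ E <= om)%N -> a%:R <= 2%:R ^- E * om%:R :> rat.
Proof.
by move=> h; rewrite mulrC ler_pdivlMr ?exprn_gt0 // -natrX -natrM ler_nat.
Qed.

Lemma touching_prod i m : (#|U i| <= m)%N ->
  (1 - 2%:R ^- e1) ^+ (2 * m * K1) * (1 - 2%:R ^- e2) ^+ (2 * m * K2)
    <= \prod_(j in touching i) (1 - x j) :> rat.
Proof.
move=> cU; rewrite big_sumType /= !prodr_const.
have le1 e k k' : (0 < e)%N -> (k' <= k)%N ->
    (1 - 2%:R ^- e : rat) ^+ k <= (1 - 2%:R ^- e) ^+ k'.
  move=> e0 kk; have /andP [h1 h2] := half_unit e0; apply: ler_wiXn2l => //; first by rewrite subr_ge0 ltW.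
  by rewrite gerBl.
have ge0 e k : (0 < e)%N -> 0 <= (1 - 2%:R ^- e : rat) ^+ k.
  by move=> e0; have /andP [h1 h2] := half_unit e0; rewrite exprn_ge0 // subr_ge0 ltW.
apply: ler_pM; rewrite ?ge0 //; apply: le1 => //.
  apply: (@leq_trans (2 * #|U i| * K1)); last by rewrite leq_mul2r leq_mul2l cU !orbT.
  apply: leq_trans (touching_count piK (U i) mult1); apply/subset_leq_card/subsetP => j.
  by move=> h; have : inl j \in touching i := h; rewrite !inE => /andP [].
apply: (@leq_trans (2 * #|U i| * K2)); last by rewrite leq_mul2r leq_mul2l cU !orbT.
apply: leq_trans (touching_count piK (U i) mult2); apply/subset_leq_card/subsetP => j.
by move=> h; have : inr j \in touching i := h; rewrite !inE => /andP [].
Qed.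

(** A class with few touching events relative to its weight contributes a factor at least [3/4]; two
    such factors exceed [1/2], whence the 1 in the exponents of [P1] and [P2]. An event of the
    second class may touch very many of the first; that factor is only bounded by [2^-Y], and [P2]
    asks for events rare enough to absorb it. *)
Theorem labeling_exists : (0 < #|L|)%N ->
  exists w : Omega, (forall i, w \notin A1 i) /\ (forall i, w \notin A2 i).
Proof.
have half' : (2%:R^-1 : rat) <= 3%:R / 4%:R by lra.
have half : (2%:R^-1 : rat) <= 3%:R / 4%:R * (3%:R / 4%:R) by lra.
have p3 : (0 : rat) <= 3%:R / 4%:R by rewrite divr_ge0.
move=> L0; have om0 : (0 < #|Omega|)%N by rewrite card_ffun expn_gt0 L0.
have b11 := @exp_one_sub_ge e1 (2 * m1 * K1); have b12 := @exp_one_sub_ge e2 (2 * m1 * K2).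
have b22 := @exp_one_sub_ge e2 (2 * m2 * K2); have b21 := @exp_one_sub_ge2 e1 (2 * m2 * K1) Y e10.
have [||||w hw] := @local_lemma V L (I1 + I2)%type A (fun i => rep @: U i) x.
- by case=> i; apply: depends_determined; [apply: dep1 | apply: dep2].
- by case=> i; apply: half_unit.
- case=> i.
    have h := touching_prod (i := inl i) (cU1 i).
    apply: (le_trans (ratio_le (P1 i))); rewrite exprD invfM expr1.
    apply: ler_wpM2r; first exact: ler0n.
  apply: ler_wpM2l; first by rewrite invr_ge0 exprn_ge0 ?ler0n.
    apply: le_trans h; apply: (le_trans half).
    by apply: (ler_pM p3 p3); [apply: b11 | apply: b12]; rewrite !mulnA.
  have h := touching_prod (i := inr i) (cU2 i).
  apply: (le_trans (ratio_le (P2 i))).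
  rewrite !exprD !invfM expr1 -mulrA [2%:R^-1 * _]mulrC.
  apply: ler_wpM2r; first exact: ler0n.
  apply: ler_wpM2l; first by rewrite invr_ge0 exprn_ge0 ?ler0n.
  have hY : 0 <= 2%:R ^- Y :> rat by rewrite invr_ge0 exprn_ge0 ?ler0n.
  have h2 : 0 <= 2%:R^-1 :> rat by rewrite invr_ge0 ler0n.
  apply: le_trans h; apply: (ler_pM hY h2).
    by apply: b21; rewrite !mulnA.
  by apply: (le_trans half'); apply: b22; rewrite !mulnA.
- exact: om0.
by exists w; split=> i; [apply: (hw (inl i)) | apply: (hw (inr i))].
Qed.
End TwoClasses.

(** * Balanced bisections and labellings *)

Section Bisections.
Set Implicit Arguments. Unset Strict Implicit. Unset Printing Implicit Defensive.
Local Open Scope nat_scope.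
Variables (V : finType) (pi : V -> V).
Hypotheses (piK : involutive pi) (pi_fpf : forall v, pi v != v).

Section Event.
Variables (L : finType) (comp : L -> L) (b : L -> bool).
Hypotheses (compK : involutive comp) (b_comp : forall l, b (comp l) = ~~ b l).
Local Notation Omega := {ffun V -> L}.

Definition unbalanced (S : {set V}) D : {set Omega} :=
  [set w | (disagree pi comp S b w + D <= agree pi comp S b w) ||
           (agree pi comp S b w + D <= disagree pi comp S b w)].

Lemma unbalanced_depends S D : depends pi comp (unbalanced S D) S.
Proof.
move=> w w' ww; rewrite !inE.
have -> : agree pi comp S b w = agree pi comp S b w'.
  by apply: eq_card => u; rewrite !inE; case uS: (u \in S) => //=; rewrite ww.
have -> // : disagree pi comp S b w = disagree pi comp S b w'.
by apply: eq_card => u; rewrite !inE; case uS: (u \in S) => //=; rewrite ww.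
Qed.

Lemma unbalanced_card (S : {set V}) M N E : 0 < N -> #|S| <= M * (2 * N) ^ 2 -> E < 2 * M ->
  #|unbalanced S (3 * M * (2 * N))| * 2 ^ E <= #|Omega|.
Proof.
move=> N0 cS EM; have h1 := chernoff piK pi_fpf compK b_comp N0 cS.
have bc l : ~~ b (comp l) = ~~ ~~ b l by rewrite b_comp.
have h2 := chernoff piK pi_fpf compK bc N0 cS.
pose B b' := [set w | disagree pi comp S b' w + 3 * M * (2 * N) <= agree pi comp S b' w].
have cE : #|unbalanced S (3 * M * (2 * N))| <= #|B b| + #|B (fun l => ~~ b l)|.
  apply: leq_trans (leq_of_leqif (leq_card_setU _ _)); apply/subset_leq_card/subsetP => w; rewrite !inE.
  case/orP => [h|h]; first by rewrite h.
  apply/orP; right; apply: leq_trans h; rewrite leq_add2r.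
  by apply/subset_leq_card/subsetP => u; rewrite !inE negbK.
have : 2 * (#|unbalanced S (3 * M * (2 * N))| * 2 ^ E) <= 2 * #|Omega|.
  apply: (@leq_trans ((#|B b| + #|B (fun l => ~~ b l)|) * 2 ^ (2 * M))).
    by rewrite mulnCA -expnS leq_mul // leq_pexp2l.
  by rewrite mulnDl [leqRHS]mul2n -addnn leq_add.
by rewrite leq_mul2l.
Qed.
End Event.

Definition deg (g : rel V) v := #|[set u | g v u]|.
Definition crossing (x : V -> bool) (g : rel V) : rel V := fun u v => g u v && (x u != x v).
Definition within (x : V -> bool) (g : rel V) : rel V := fun u v => g u v && (x u == x v).

Definition splits (x : V -> bool) (g : rel V) D := forall v,
  deg (crossing x g) v <= deg (within x g) v + D /\
  deg (within x g) v <= deg (crossing x g) v + D.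

Definition antipodal (x : V -> bool) := forall v, x (pi v) = ~~ x v.

Lemma deg_within_crossing x g v : deg (within x g) v + deg (crossing x g) v = deg g v.
Proof.
rewrite /deg -(cardsID [set u | x v == x u] [set u | g v u]).
by congr (_ + _); apply: eq_card => u; rewrite !inE // andbC.
Qed.

Lemma unbalanced_splits (L : finType) (comp : L -> L) (b : L -> bool) (g : rel V) D w :
  (forall v, w \notin unbalanced comp b [set u | g v u] D) ->
  splits (fun v => b (labeling pi comp w v)) g D.
Proof.
move=> h v; have := h v; rewrite inE negb_or -!ltnNge => /andP [h1 h2].
have agreeE : agree pi comp [set u | g v u] b w = #|[set u | g v u && b (labeling pi comp w u)]|.
  by apply: eq_card => u; rewrite !inE.
have disE : disagree pi comp [set u | g v u] b w = #|[set u | g v u && ~~ b (labeling pi comp w u)]|.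
  by apply: eq_card => u; rewrite !inE.
have lE (y : bool) : #|[set u | g v u && (y == b (labeling pi comp w u))]| =
    if y then #|[set u | g v u && b (labeling pi comp w u)]|
    else #|[set u | g v u && ~~ b (labeling pi comp w u)]|.
  by case: y; apply: eq_card => u; rewrite !inE; case: (b _).
have gE (y : bool) : #|[set u | g v u && (y != b (labeling pi comp w u))]| =
    if y then #|[set u | g v u && ~~ b (labeling pi comp w u)]|
    else #|[set u | g v u && b (labeling pi comp w u)]|.
  by case: y; apply: eq_card => u; rewrite !inE; case: (b _).
rewrite agreeE disE in h1 h2; rewrite /deg /within /crossing lE gE.
by case: (b (labeling pi comp w v)); split; apply: ltnW.
Qed.

(* [3 * M * (2 * N)] in [chernoff] for [M = b + 3] and [2 * N = 2 ^ uphalf b]. *)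
Definition dev b := 3 * (b + 3) * 2 ^ uphalf b.

Lemma uphalf_pred_pow b : 0 < b -> 2 * 2 ^ (uphalf b).-1 = 2 ^ uphalf b.
Proof. by case: b => // b _; rewrite -expnS. Qed.

Lemma sq_uphalf b : 2 ^ b <= (2 ^ uphalf b) ^ 2.
Proof. by rewrite -expnM leq_exp2l // muln2 uphalf_half -{1}(odd_double_half b) doubleD leq_add2r; case: (odd b). Qed.

(* In the local lemma, the events for [q] get weight [2^-(2b+3)], those for [g] weight
   [2^-(2beta+4)]. *)
Lemma balanced_bisection (q : rel V) (g : bool -> rel V) (b beta c : nat) :
  symmetric q -> (forall v, deg q v <= 2 ^ b) ->
  (forall k v, deg (g k) v <= 2 ^ beta) -> (forall k v, #|[set u | g k u v]| <= 2 ^ beta) ->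
  0 < b <= beta -> 0 < c -> 2 * c < b -> 2 * c <= beta -> 2 * beta + 6 <= 2 ^ (beta - 2 * c) ->
  exists x : V -> bool, [/\ antipodal x, splits x q (dev b) &
    forall k, splits x (g k) (3 * 2 ^ (beta - c))].
Proof.
move=> qs dq dg idg /andP [b0 bb] c0 cb cbeta hb.
have negb_comp (l : bool) : id (~~ l) = ~~ id l by [].
(* In [chernoff], [M = M2] and [2 * N = 2 ^ c] give [M * (2 * N) ^ 2 = 2 ^ beta] and the deviation
   [3 * 2 ^ (beta - c)], with failure probability of order [2 ^ - (2 * M2)]. *)
pose M2 := 2 ^ (beta - 2 * c).
have D2 : 3 * M2 * (2 * 2 ^ c.-1) = 3 * 2 ^ (beta - c).
  rewrite -expnS prednK // -mulnA -expnD; congr (_ * 2 ^ _).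
  by move: cbeta; clear; lia.
have D1 : 3 * (b + 3) * (2 * 2 ^ (uphalf b).-1) = dev b by rewrite uphalf_pred_pow.
pose N (g : rel V) v := [set u | g v u].
(* The last argument, [Y], is just large enough for the events of [q] touched by one of [g]; it
   stays below [M2] because [2 * c < b]. *)
have [|||||||||||||||w [w1 w2]] := @labeling_exists V bool pi negb piK V (bool * V)%type
  (fun v => unbalanced negb id (N q v) (dev b))
  (fun kv => unbalanced negb id (N (g kv.1) kv.2) (3 * 2 ^ (beta - c)))
  (N q) (fun kv => N (g kv.1) kv.2)
  (2 ^ b) (2 ^ b) (2 ^ beta) (2 * 2 ^ beta) (2 * b + 3) (2 * beta + 4) (2 ^ (beta - b.+1)).
- by move=> v; apply: unbalanced_depends.
- by move=> kv; apply: unbalanced_depends.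
- exact: dq.
- by move=> kv; apply: dg.
- by move=> v; apply: leq_trans (dq v); apply/subset_leq_card/subsetP => u; rewrite !inE qs.
- move=> v.
  apply: (@leq_trans #|[set (true, u) | u in [set u | g true u v]] :|: [set (false, u) | u in [set u | g false u v]]|).
    apply/subset_leq_card/subsetP => -[k u]; rewrite !inE /= => gk; apply/orP.
    by case: k gk => gk; [left|right]; apply: imset_f; rewrite inE.
  apply: leq_trans (leq_of_leqif (leq_card_setU _ _)) _; rewrite mul2n -addnn leq_add //.
    by apply: leq_trans (leq_imset_card _ _) _.
  by apply: leq_trans (leq_imset_card _ _) _.
- by rewrite addn3.
- by rewrite addn4.
- by rewrite -mulnA -expnD (_ : 8 = 2 ^ 3) // -expnD leq_exp2l //; clear; lia.
- by rewrite (_ : 8 = 2 ^ 3) // -expnS -!expnD leq_exp2l //; move: bb; clear; lia.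
- by rewrite (_ : 8 = 2 ^ 3) // -expnS -!expnD leq_exp2l //; clear; lia.
- by rewrite (_ : 4 = 2 ^ 2) // -!expnD leq_exp2l //; clear; lia.
- move=> v; rewrite -D1; apply: unbalanced_card => //; first exact: negbK.
  + by rewrite expn_gt0.
  + rewrite uphalf_pred_pow //; apply: (leq_trans (dq v)); apply: (leq_trans (sq_uphalf b)).
    by rewrite -[X in X <= _]mul1n leq_mul2r addn3 orbT.
  + by clear; lia.
- move=> kv; rewrite -D2; apply: unbalanced_card => //; first exact: negbK.
  + by rewrite expn_gt0.
  + rewrite -expnS prednK // -expnM -expnD; apply: (leq_trans (dg _ _)); rewrite leq_exp2l //.
    by move: cbeta; clear; lia.
  + have h : 2 ^ (beta - b.+1) <= M2 by rewrite leq_exp2l //; move: cb; clear; lia.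
    by move: h hb; rewrite -/M2; clearbody M2; clear; move: (2 ^ (beta - b.+1)); lia.
- by rewrite card_bool.
exists (fun v => id (labeling pi negb w v)); split=> [v||k].
- by rewrite labeling_pi //; exact: negbK.
- exact: (@unbalanced_splits _ negb id q _ w w1).
- by apply: (@unbalanced_splits _ negb id (g k) _ w) => v; apply: (w2 (k, v)).
Qed.

End Bisections.

(** * Proper colourings by binary words *)

Section BinaryLabels.
Set Implicit Arguments. Unset Strict Implicit. Unset Printing Implicit Defensive.
Local Open Scope nat_scope.
Variables (V : finType) (pi : V -> V).
Hypotheses (piK : involutive pi) (pi_fpf : forall v, pi v != v).

(** Overwriting the coordinate at [rep pi v] by any label is injective on the event, where the other
    coordinates determine the one overwritten. If [u] and [v] are matched, the event is empty. *)
Lemma monochromatic_card (L : finType) (comp : L -> L) u v :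
  involutive comp -> (forall l, comp l != l) -> u != v ->
  #|[set w | labeling pi comp w u == labeling pi comp w v]| * #|L| <= #|{ffun V -> L}|.
Proof.
move=> compK comp_fpf uv; set B := [set w | _].
have [E|vpu] := eqVneq v (pi u).
  rewrite (_ : B = set0) ?cards0 //; apply/setP => w; rewrite !inE E labeling_pi //.
  by rewrite eq_sym (negPf (comp_fpf _)).
have ruv : rep pi v != rep pi u.
  apply/eqP => /(rep_eq piK) [E|E]; first by rewrite E eqxx in uv.
  by rewrite E piK eqxx in vpu.
pose phi (wl : {ffun V -> L} * L) : {ffun V -> L} :=
  [ffun t => if t == rep pi v then wl.2 else wl.1 t].
rewrite -cardsT -cardsX -(card_in_imset (f := phi)); first exact: max_card.
move=> [w l] [w' l'] /setXP [wB _] /setXP [wB' _] /ffunP E.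
have El : l = l' by have := E (rep pi v); rewrite !ffunE eqxx.
have Ew t : t != rep pi v -> w t = w' t.
  by move=> tv; have := E t; rewrite !ffunE (negPf tv).
rewrite El; congr (_, _); apply/ffunP => t.
have [->|] := eqVneq t (rep pi v); last exact: Ew.
move: wB wB'; rewrite !inE => /eqP h /eqP h'.
have : labeling pi comp w v = labeling pi comp w' v.
  by rewrite -h -h'; apply: labeling_eq; apply: Ew; rewrite eq_sym.
rewrite /labeling /rep; case: (lead pi v) => // /(can_inj compK) //.
Qed.

(* As in [balanced_bisection], with local-lemma weights [2^-(a+5+2c)] for a monochromatic
   edge of [q] and [2^-(3beta)] for a vertex and a bit splitting [g] badly. *)
Lemma balanced_labels (q g : rel V) (a beta c : nat) :
  symmetric q -> irreflexive q -> (forall v, deg q v <= 2 ^ a) ->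
  symmetric g -> (forall v, deg g v <= 2 ^ beta) ->
  0 < c -> 2 * c + 2 <= beta -> 8 * (a + 6 + 2 * c) <= 2 ^ beta ->
  3 * beta + 2 <= 2 ^ (beta - 2 * c) ->
  exists x : 'I_(a + 6 + 2 * c) -> V -> bool,
  [/\ forall i, antipodal pi (x i), forall u v, q u v -> exists i, x i u != x i v &
      forall i, splits (x i) g (3 * 2 ^ (beta - c))].
Proof.
(* Length [a + 6] would serve the edge events alone. The other [2 * c] bits lower their weight until
   [Y = 2 ^ (beta - (2 + 2 * c))] is a quarter of [2 ^ (beta - 2 * c)]. *)
set j := a + 6 + 2 * c => qs qi dq gs dg c0 cbeta jb hb.
pose L := {ffun 'I_j -> bool}.
pose comp (l : L) : L := [ffun i => ~~ l i].
have compK : involutive comp by move=> l; apply/ffunP => i; rewrite !ffunE negbK.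
have j0 : 0 < j by rewrite /j addn_gt0 addn_gt0 orbT.
have comp_fpf l : comp l != l.
  by apply/eqP => /ffunP /(_ (Ordinal j0)); rewrite ffunE; case: (l _).
have bit_comp i (l : L) : (comp l) i = ~~ l i by rewrite ffunE.
have cL : #|L| = 2 ^ j by rewrite card_ffun card_bool card_ord.
pose M2 := 2 ^ (beta - 2 * c).
have D2 : 3 * M2 * (2 * 2 ^ c.-1) = 3 * 2 ^ (beta - c).
  rewrite -expnS prednK // -mulnA -expnD; congr (_ * 2 ^ _).
  by move: cbeta; clear; lia.
pose N v := [set u | g v u].
have [|||||||||||||||w [w1 w2]] := @labeling_exists V L pi comp piK (V * V)%type (V * 'I_j)%type
  (fun uv => if q uv.1 uv.2 then [set w | labeling pi comp w uv.1 == labeling pi comp w uv.2] else set0)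
  (fun vi => unbalanced pi comp (fun l => l vi.2) (N vi.1) (3 * 2 ^ (beta - c)))
  (fun uv => if q uv.1 uv.2 then [set uv.1; uv.2] else set0) (fun vi => N vi.1)
  2 (2 * 2 ^ a) (2 ^ beta) (j * 2 ^ beta) (a + 5 + 2 * c) (3 * beta) (2 ^ (beta - (2 + 2 * c))).
- move=> [u v] w w' /= ww; case: (q u v) ww => [ww|]; last by rewrite !inE.
  by rewrite !inE !ww // !inE eqxx ?orbT.
- by move=> vi; apply: unbalanced_depends.
- move=> [u v] /=; case: (q u v); last by rewrite cards0.
  by rewrite cards2; case: (_ != _).
- by move=> vi; apply: dg.
- move=> v.
  apply: (@leq_trans #|[set (v, u) | u in [set u | q v u]] :|: [set (u, v) | u in [set u | q v u]]|).
    apply/subset_leq_card/subsetP => -[u u']; rewrite !inE /=.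
    case quu: (q u u'); last by rewrite inE.
    rewrite !inE => /orP [] /eqP E; subst v; apply/orP; [left|right]; apply: imset_f.
      by rewrite inE.
    by rewrite inE qs.
  apply: leq_trans (leq_of_leqif (leq_card_setU _ _)) _; rewrite mul2n -addnn leq_add //.
    by apply: leq_trans (leq_imset_card _ _) _; apply: dq.
  by apply: leq_trans (leq_imset_card _ _) _; apply: dq.
- move=> v.
  apply: (@leq_trans #|setX (N v) [set: 'I_j]|).
    by apply/subset_leq_card/subsetP => -[u i]; rewrite !inE /= gs andbT.
  by rewrite cardsX cardsT card_ord mulnC leq_mul2l; apply/orP; right; apply: dg.
- by rewrite addnAC addn_gt0 orbT.
- by rewrite muln_gt0 /=; move: cbeta; clear; lia.
- rewrite (_ : 8 * 2 * (2 * 2 ^ a) = 2 ^ (a + 5)) ?leq_exp2l ?leq_addr //.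
  by rewrite expnD mulnC; clear; lia.
- apply: (@leq_trans (2 ^ beta * 2 ^ (beta.+1))); last by rewrite -expnD leq_exp2l //; move: cbeta; clear; lia.
  rewrite expnS mulnCA; move: jb; clearbody j; clear; move: (2 ^ beta); nia.
- rewrite mulnACA; apply: (@leq_trans (2 ^ beta * (2 ^ beta * 2 ^ beta))).
    by rewrite leq_mul2r jb orbT.
  by rewrite -!expnD leq_exp2l //; clear; lia.
- by rewrite (_ : 4 = 2 ^ 2) // -expnS -!expnD leq_exp2l //; move: cbeta; clear; lia.
- move=> [u v] /=; case quv: (q u v); last by rewrite cards0.
  rewrite (_ : a + 5 + 2 * c + 1 = j); last by rewrite /j; clear; lia.
  rewrite -cL; apply: monochromatic_card => //.
  by apply: contraTneq quv => ->; rewrite qi.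
- move=> [v i]; rewrite -D2; apply: unbalanced_card => //.
  + by rewrite expn_gt0.
  + rewrite -expnS prednK // -expnM -expnD; apply: (leq_trans (dg _)); rewrite leq_exp2l //.
    by move: cbeta; clear; lia.
  + have h : 2 ^ (beta - (2 + 2 * c)) <= M2 by rewrite leq_exp2l //; clear; lia.
    by move: h hb; rewrite -/M2; clearbody M2; clear; move: (2 ^ (beta - (2 + 2 * c))); lia.
- by rewrite cL expn_gt0.
exists (fun i v => labeling pi comp w v i); split=> [i v|u v quv|i].
- by rewrite labeling_pi // ffunE.
- have := w1 (u, v); rewrite /= quv inE => h; apply/existsP; rewrite -negb_forall.
  by apply: contra h => /forallP h; apply/eqP/ffunP => i; apply/eqP; have := h i; rewrite ?negbK.
- by apply: (@unbalanced_splits _ _ _ comp (fun l => l i) g _ w) => v; apply: (w2 (v, i)).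
Qed.
End BinaryLabels.

(** * Regular completions and decompositions *)

Section RegularBipartite.
Set Implicit Arguments. Unset Strict Implicit. Unset Printing Implicit Defensive.
Local Open Scope nat_scope.

Section Relations.
Variable V : finType.
Implicit Types (g h q : rel V) (A B S : {set V}).

Definition union_rel g h : rel V := fun u v => g u v || h u v.
Definition diff_rel g h : rel V := fun u v => g u v && ~~ h u v.

Lemma union_rel_sym g h : symmetric g -> symmetric h -> symmetric (union_rel g h).
Proof. by move=> gs hs u v; rewrite /union_rel gs hs. Qed.

Lemma diff_rel_sym g h : symmetric g -> symmetric h -> symmetric (diff_rel g h).
Proof. by move=> gs hs u v; rewrite /diff_rel gs hs. Qed.

Lemma crossing_sym (x : V -> bool) g : symmetric g -> symmetric (crossing x g).
Proof. by move=> gs u v; rewrite /crossing gs eq_sym. Qed.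

Lemma within_sym (x : V -> bool) g : symmetric g -> symmetric (within x g).
Proof. by move=> gs u v; rewrite /within gs eq_sym. Qed.

Lemma deg_eq g h v : (forall u, g v u = h v u) -> deg g v = deg h v.
Proof. by move=> gh; apply: eq_card => u; rewrite !inE gh. Qed.

Lemma deg_sub g h v : subrel g h -> deg g v <= deg h v.
Proof. by move=> gh; apply/subset_leq_card/subsetP => u; rewrite !inE => /gh. Qed.

Lemma deg_union_rel g h v : (forall u, g v u -> ~~ h v u) -> deg (union_rel g h) v = deg g v + deg h v.
Proof.
move=> gh; rewrite /deg -cardsUI [X in _ = _ + X](_ : _ = 0) ?addn0.
  by apply: eq_card => u; rewrite !inE.
apply/eqP; rewrite cards_eq0; apply/eqP/setP => u; rewrite !inE.
by case guv: (g v u) => //=; apply/negbTE/gh.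
Qed.

Lemma deg_diff_rel g h v : subrel h g -> deg (diff_rel g h) v + deg h v = deg g v.
Proof.
move=> hg; rewrite -deg_union_rel; last by move=> u /andP [].
by apply: deg_eq => u; rewrite /union_rel /diff_rel; case guv: (g v u) => //=; [case: (h v u) | apply/negP => /hg; rewrite guv].
Qed.

Lemma deg_degin g S v : (forall u, g v u -> u \in S) -> deg g v = degin g S v.
Proof. by move=> gS; apply: eq_card => u; rewrite !inE; case guv: (g v u); rewrite ?andbF // gS. Qed.

Lemma expander_factor_rel e g d m dl s A B (f : V -> nat) :
  mixing e d -> symmetric g -> subrel g e -> #|B| = m -> [disjoint A & B] ->
  (forall v, v \in A :|: B -> s <= f v /\ 8 * f v <= 9 * s) ->
  \sum_(v in A) f v = \sum_(v in B) f v ->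
  (forall v, v \in A -> dl <= degin g B v) -> (forall v, v \in B -> dl <= degin g A v) ->
  192 * 9 * m * d + 289 * #|V| * d + 17 * 216 * s * #|V| <= 17 * 192 * #|V| * dl ->
  exists h, [/\ symmetric h, subrel h g,
    forall u v, h u v -> (u \in A) && (v \in B) || (u \in B) && (v \in A) &
    forall v, v \in A :|: B -> deg h v = f v].
Proof.
move=> mx gs ge cB AB fs fAB dA dB H.
have [M [Mg MA MB]] := expander_factor mx gs ge cB fs fAB dA dB H.
have nAB v : v \in A -> v \in B -> False by move=> vA; rewrite (disjointFr AB vA).
exists (fun u v => ((u, v) \in M) || ((v, u) \in M)); split=> [u v|u v|u v|v].
- by rewrite orbC.
- by case/orP => /Mg [] // _ _; rewrite gs.
- by case/orP => /Mg [-> -> _]; rewrite ?orbT.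
- rewrite inE => /orP [vA|vB].
    rewrite -MA //; apply: eq_card => u; rewrite !inE; case: ((v, u) \in M) => //=.
    by apply/negP => /Mg [_ vB _]; apply: (nAB v).
  rewrite -MB //; apply: eq_card => u; rewrite !inE orbC; case: ((u, v) \in M) => //=.
  by apply/negP => /Mg [vA _ _]; apply: (nAB v).
Qed.

Variable pi : V -> V.
Hypothesis piK : involutive pi.

Lemma antipodal_card (x : V -> bool) (P : bool -> pred V) : antipodal pi x ->
  (forall b v, P b v = P (~~ b) (pi v)) -> #|[set v | P true v]| = #|[set v | P false v]|.
Proof.
move=> xa Ppi; rewrite -(card_imset _ (inv_inj piK)); apply: eq_card => v; rewrite inE.
apply/imsetP/idP => [[u uP ->]|vP].
  by move: uP; rewrite inE Ppi.
by exists (pi v); rewrite ?piK // inE Ppi /= piK.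
Qed.

(** The target [l + 9 * w] leaves between [8 * w] and [9 * w] missing at each vertex, which is the
    ratio 9/8 that [expander_factor] tolerates. The missing degrees have equal sums on both sides,
    since the sides have equal size and every edge of [q] crosses. *)
Lemma regular_completion e d (x : V -> bool) q g l w :
  mixing e d -> antipodal pi x -> symmetric q -> (forall u v, q u v -> x u != x v) ->
  (forall v, l <= deg q v <= l + w) -> symmetric g -> subrel g e ->
  (forall v, 1153 * d + 3264 * (9 * w) <= 3264 * deg (crossing x g) v) ->
  exists h, [/\ symmetric h, subrel h (crossing x g) & forall v, deg q v + deg h v = l + 9 * w].
Proof.
move=> mx xa qs qx dq gs ge H.
pose A := [set v | x v]; pose B := [set v | ~~ x v].
have cAB : #|A| = #|B|.
  by apply: (@antipodal_card x (fun b v => if b then x v else ~~ x v)) => // -[] v; rewrite xa ?negbK.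
have ABT : A :|: B = setT by apply/setP => v; rewrite !inE orbN.
have disAB : [disjoint A & B] by rewrite -setI_eq0; apply/eqP/setP => v; rewrite !inE andbN.
have cV : 2 * #|A| = #|V|.
  rewrite mul2n -addnn {2}cAB -cardsT -ABT cardsU; move: disAB; rewrite -setI_eq0 => /eqP ->.
  by rewrite cards0 subn0.
have degA (r : rel V) v : v \in A -> degin (crossing x r) B v = deg (crossing x r) v.
  rewrite inE => vA; rewrite (@deg_degin _ B) // => u; rewrite !inE /crossing vA => /andP [_].
  by case: (x u).
have degB (r : rel V) v : v \in B -> degin (crossing x r) A v = deg (crossing x r) v.
  rewrite inE => vB; rewrite (@deg_degin _ A) // => u; rewrite !inE /crossing (negPf vB) => /andP [_].
  by case: (x u).
have qE v : deg q v = deg (crossing x q) v.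
  by apply: deg_eq => u; rewrite /crossing; case quv: (q v u) => //=; rewrite qx.
have sq : \sum_(v in A) deg q v = \sum_(v in B) deg q v.
  rewrite (eq_bigr _ (fun v _ => qE v)) [RHS](eq_bigr _ (fun v _ => qE v)).
  rewrite (eq_bigr _ (fun v vA => esym (degA q v vA))) sum_degin_sym; last exact: crossing_sym.
  by apply: eq_bigr => v vB; apply: degB.
pose f v := l + 9 * w - deg q v.
(* The assumed lower bound, rounded up. Here [1153 / 3264 = 9/34 + 17/192] is the requirement of
   [mixing_arith] for [m = #|V| / 2], and [9 * w] is [9/8] of [s = 8 * w]. *)
pose dl := (1153 * d + 3264 * (9 * w) + 3263) %/ 3264.
have dlP v : dl <= deg (crossing x g) v by move: (H v); rewrite /dl; clear; lia.
have [||||||h [hs hg hAB hf]] := @expander_factor_rel e (crossing x g) d #|A| dl (8 * w) A B f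
    mx (crossing_sym x gs) _ (esym cAB) disAB.
- by move=> u v /andP [/ge].
- by move=> v _; move: (dq v); rewrite /f; clear; lia.
- have sf S : (\sum_(v in S) f v) + \sum_(v in S) deg q v = #|S| * (l + 9 * w).
    rewrite -big_split -sum_nat_const; apply: eq_bigr => v _ /=.
    by rewrite /f subnK //; move: (dq v); clear; lia.
  by move: (sf A) (sf B); rewrite sq cAB; clear; lia.
- by move=> v vA; rewrite degA.
- by move=> v vB; rewrite degB.
- have : 1153 * d + 3264 * (9 * w) <= 3264 * dl by rewrite /dl; clear; lia.
  move/(leq_mul (leqnn (2 * #|A|))); rewrite -cV; clearbody dl; clear; lia.
exists h; split=> // v; rewrite hf ?ABT ?inE //.
by rewrite /f subnKC //; move: (dq v); clear; lia.
Qed.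

End Relations.

Section Decompositions.
Variable n : nat.
Implicit Types (g h : rel 'I_n).

Definition decomposable k g := exists H : 'I_k -> rel 'I_n, reg_bip_decomposition g H.

Lemma decomposable_eq k g h : (forall u v, g u v = h u v) -> decomposable k g -> decomposable k h.
Proof.
move=> gh [H [[h1 h2 h3 h4] h5]]; exists H; split=> //; split=> //.
  by move=> i u v; rewrite -gh; apply: h2.
by move=> u v; rewrite -gh; apply: h4.
Qed.

Lemma decomposable1 g (x : 'I_n -> bool) r : symmetric g ->
  (forall u v, g u v -> x u != x v) -> (forall v, deg g v = r) -> decomposable 1 g.
Proof.
move=> gs gx gr; exists (fun _ => g); split; first split=> //.
- by move=> _; split=> // v; apply/negP => /gx; rewrite eqxx.
- by move=> i j u v; rewrite !ord1 eqxx.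
- by move=> u v guv; exists ord0.
by move=> _; split; [exists r | exists x].
Qed.

Lemma decomposableU k1 k2 g h : (forall u v, g u v -> ~~ h u v) ->
  decomposable k1 g -> decomposable k2 h -> decomposable (k1 + k2) (union_rel g h).
Proof.
move=> gh [G [[g1 g2 g3 g4] g5]] [H [[h1 h2 h3 h4] h5]].
exists (fun i => match split i with inl j => G j | inr j => H j end); split; first split.
- by move=> i; case: (split i).
- by move=> i u v; rewrite /union_rel; case: (split i) => j; [move/g2 -> | move/h2 ->; rewrite orbT].
- move=> i j u v; rewrite -(inj_eq (can_inj (@splitK k1 k2))).
  case: (split i) => i'; case: (split j) => j' ij.
  + by apply: g3; apply: contra ij => /eqP ->.
  + by apply/negP => /andP [/g2 /gh h' /h2]; apply/negP.
  + by apply/negP => /andP [/h2 h' /g2 /gh]; rewrite h'.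
  + by apply: h3; apply: contra ij => /eqP ->.
- move=> u v /orP [/g4 [i Gi]|/h4 [i Hi]].
    by exists (unsplit (inl i)); rewrite unsplitK.
  by exists (unsplit (inr i)); rewrite unsplitK.
by move=> i; case: (split i).
Qed.

(** Applied to the part already removed, to see that what remains of a regular graph is regular. *)
Lemma decomposable_regular k g : decomposable k g -> exists r, forall v, deg g v = r.
Proof.
move=> [H [[h1 h2 h3 h4] h5]].
have [r Hr] : exists r : 'I_k -> nat, forall i v, deg (H i) v = r i.
  have hr i : exists r, forall v, deg (H i) v = r by have [[r Hr] _] := h5 i; exists r.
  by have [r Hr] := fin_all_exists hr; exists r.
exists (\sum_i r i) => v.
rewrite (eq_bigr _ (fun i _ => esym (Hr i v))) /deg -sum1dep_card.
under [RHS]eq_bigr do rewrite -sum1dep_card big_mkcond.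
rewrite exchange_big big_mkcond; apply: eq_bigr => u _ /=.
case gvu: (g v u); last by rewrite big1 // => i _; case: ifP => // /h2; rewrite gvu.
have [i Hi] := h4 _ _ gvu; rewrite (bigD1 i) //= Hi big1 // => j ji.
by have := h3 j i v u ji; rewrite Hi andbT => /negPf ->.
Qed.
End Decompositions.
End RegularBipartite.

(** * Decomposing the edges inside the cells *)

Section Levels.
Set Implicit Arguments. Unset Strict Implicit. Unset Printing Implicit Defensive.
Local Open Scope nat_scope.
Variables (n : nat) (pi : 'I_n -> 'I_n) (e : rel 'I_n) (d : nat).
Hypotheses (piK : involutive pi) (pi_fpf : forall v, pi v != v) (mx : mixing e d).
Implicit Types (g h q : rel 'I_n) (x : 'I_n -> bool).

(** One step of the recursion: [q] must be used up, [g] is the reservoir and [g'] the part of it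
    that survives. The cut edges of [q] and their completion [h] form one graph. *)
Lemma peel x q g h g' r k : symmetric q -> symmetric h -> subrel h (crossing x g) ->
  (forall u v, q u v -> ~~ g u v) -> (forall v, deg (crossing x q) v + deg h v = r) ->
  subrel g' (diff_rel g h) -> decomposable k (union_rel (within x q) (diff_rel (diff_rel g h) g')) ->
  decomposable k.+1 (union_rel q (diff_rel g g')).
Proof.
move=> qs hs hg qg hr g'g dk.
have hg' u v : h u v -> g u v /\ x u != x v by move/hg/andP.
have E u v : union_rel (union_rel (crossing x q) h) (union_rel (within x q) (diff_rel (diff_rel g h) g')) u v =
    union_rel q (diff_rel g g') u v.
  have /implyP := g'g u v; have /implyP := hg u v; rewrite /union_rel /diff_rel /crossing /within.
  by case: (h u v); case: (g' u v); case: (q u v); case: (x u == x v); case: (g u v).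
apply: decomposable_eq E _; rewrite -add1n; apply: decomposableU => //.
  move=> u v; apply/implyP; have /implyP := hg u v; have /implyP := qg u v.
  rewrite /union_rel /diff_rel /crossing /within.
  by case: (h u v); case: (g' u v); case: (q u v); case: (x u == x v); case: (g u v).
apply: (@decomposable1 _ _ x r).
- exact: union_rel_sym (crossing_sym x qs) hs.
- by move=> u v /orP [/andP []|/hg' []].
move=> v; rewrite -(hr v) deg_union_rel // => u /andP [quv _].
by apply/negP => /hg' [guv _]; have := qg _ _ quv; rewrite guv.
Qed.

Lemma deg_crossing_diff_rel x g h v :
  deg (crossing x g) v <= deg (crossing x (diff_rel g h)) v + deg h v.
Proof.
apply: leq_trans (leq_of_leqif (leq_card_setU _ _)); apply/subset_leq_card/subsetP => u.
by rewrite !inE /crossing /diff_rel => /andP [-> ->]; case: (h v u).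
Qed.

(** One bit at a time, the last first. Nothing is known about how evenly a bit cuts [q], so each
    completion takes [l = 0] and [w = D] and costs up to [9 * D]; hence the restriction of this
    method to bounded degree. *)
Lemma peel_labels (x : nat -> 'I_n -> bool) D k q g :
  (forall i, i < k -> antipodal pi (x i)) -> symmetric q -> symmetric g -> subrel g e ->
  (forall u v, q u v -> ~~ g u v) -> (forall v, deg q v <= D) ->
  (forall u v, q u v -> exists2 i, i < k & x i u != x i v) ->
  (forall i v, i < k -> 1153 * d + 3264 * (9 * D * k) <= 3264 * deg (crossing (x i) g) v) ->
  exists g', [/\ symmetric g', subrel g' g, decomposable k (union_rel q (diff_rel g g')) &
    forall v, deg g v <= deg g' v + 9 * D * k].
Proof.
elim: k q g => [|k IH] q g xa qs gs ge qg dq qx gx.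
  exists g; split=> // [|v]; last by rewrite muln0 addn0.
  exists (fun _ _ _ => false); split; first split=> // u v; last by case.
  by move=> /orP [/qx [] //|/andP [-> ]].
have [||u v /andP [] //|v||//||h [hs hg hr]] :=
  @regular_completion _ pi piK e d (x k) (crossing (x k) q) g 0 D mx.
- exact: xa.
- exact: crossing_sym.
- by rewrite add0n /= (leq_trans _ (dq v)) // deg_sub // => u w /andP [].
- exact: gs.
- by move=> v; apply: leq_trans (gx k v (ltnSn k)); rewrite leq_add2l leq_mul2l leq_pmulr.
have hg' : subrel h g by move=> u v /hg /andP [].
have dh v : deg h v <= 9 * D by rewrite -[leqRHS]add0n -(hr v) leq_addl.
have [||||u v|v|u v|i v ik|g' [g's g'g dec dg']] := IH (within (x k) q) (diff_rel g h).
- by move=> i ik; apply: xa; apply: ltnW.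
- exact: within_sym.
- exact: diff_rel_sym.
- by move=> u v /andP [/ge].
- by move=> /andP [/qg /negPf guv _]; rewrite /diff_rel guv.
- by apply: leq_trans (dq v); apply: deg_sub => u w /andP [].
- move=> /andP [/qx [i]]; rewrite ltnS leq_eqVlt => /orP [/eqP -> /negP // | ik xi _].
  by exists i.
- move: (gx i v (ltnW ik)) (deg_crossing_diff_rel (x i) g h v) (dh v).
  by rewrite !mulnS; clear; lia.
exists g'; split=> [//|u v /g'g /andP [] //||v].
  by apply: (peel qs hs hg qg hr g'g dec).
move: (dg' v) (dh v) (deg_diff_rel v hg'); rewrite mulnS; clear; lia.
Qed.

(* [U b] bounds the degree of the graph to be bisected [b - a] times, [9 * (2 * w + S b)] the
   degree in [g] used up in the process, and [phi] is the degree in [g] that must survive. *)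
Variables (a beta phi : nat) (U S : nat -> nat).
Hypotheses (ei : irreflexive e) (ed : forall v, deg e v <= 2 ^ beta).
Hypothesis U_le : forall b, U b <= 2 ^ b.
Hypothesis U_step : forall b, a <= b -> U b.+1 + dev b.+1 <= 2 * U b.
Hypothesis S_base : 2 * (a + 6 + 2 * 10) * 2 ^ a <= S a.
Hypothesis S_step : forall b, a <= b -> S b + 3 * dev b.+1 <= S b.+1.
(** About half of the degree of [g] crosses each bisection, hence 1632 in place of the 3264 of
    [regular_completion]. *)
Hypothesis phi_large : 1153 * d + 1632 * (3 * 2 ^ (beta - 10)) <= 1632 * phi.
Hypothesis a_large : 40 <= a.
Hypothesis beta1 : 2 * beta + 6 <= 2 ^ (beta - 2 * 20).
Hypothesis beta2 : 3 * beta + 2 <= 2 ^ (beta - 2 * 10).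
Hypothesis beta3 : 8 * (a + 6 + 2 * 10) <= 2 ^ beta.

Lemma splits_deg x g D v : splits x g D -> deg g v <= 2 * deg (crossing x g) v + D.
Proof. by move=> /(_ v) [_]; rewrite -(deg_within_crossing x g v); clear; lia. Qed.

Lemma peel_base q g l w : a <= beta ->
  symmetric q -> symmetric g -> subrel q e -> subrel g e -> (forall u v, q u v -> ~~ g u v) ->
  (forall v, l <= deg q v <= l + w) -> l + w <= U a ->
  (forall v, phi + 9 * (2 * w + S a) <= deg g v) ->
  exists g', [/\ symmetric g', subrel g' g,
    decomposable (a + 6 + 2 * 10) (union_rel q (diff_rel g g')) &
    forall v, deg g v <= deg g' v + 9 * (2 * w + S a)].
Proof.
move=> ab qs gs qe ge qg dq lU gphi; set j := a + 6 + 2 * 10.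
have dqa v : deg q v <= 2 ^ a.
  by case/andP: (dq v) => _ /leq_trans; apply; apply: leq_trans (U_le a).
have qi : irreflexive q by move=> v; apply/negP => /qe; rewrite ei.
have dg v : deg g v <= 2 ^ beta by apply: leq_trans (ed v); apply: deg_sub.
have [|x [xa xq xg]] := @balanced_labels _ pi piK pi_fpf q g a beta 10 qs qi dqa gs dg isT _ beta3 beta2.
  by move: ab a_large; clear; lia.
pose x' i : 'I_n -> bool := if insub i is Some i' then x i' else xpred0.
have x'E (i : 'I_j) : x' i = x i by rewrite /x' valK.
have [||||||u v quv|i v ij|g' [h1 h2 h3 h4]] := @peel_labels x' (2 ^ a) j q g.
- by move=> i ij; rewrite (x'E (Ordinal ij)).
- by [].
- by [].
- by [].
- by [].
- by [].
- by have [i xi] := xq u v quv; exists (i : nat) => //; rewrite x'E.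
- rewrite (x'E (Ordinal ij)); move: (splits_deg v (xg (Ordinal ij))) (gphi v) phi_large S_base.
  have -> : 9 * 2 ^ a * j = 9 * (j * 2 ^ a) by rewrite -mulnA (mulnC j).
  have -> : 2 * (a + 6 + 2 * 10) * 2 ^ a = 2 * (j * 2 ^ a) by rewrite mulnA.
  by move: (j * 2 ^ a) (2 ^ (beta - 10)); clear; lia.
exists g'; split=> // v; apply: leq_trans (h4 v) _; rewrite leq_add2l -mulnA leq_mul2l /=.
by rewrite mulnC; move: S_base; rewrite -/j -mulnA; move: (j * 2 ^ a); clear; lia.
Qed.

(** A level costs at most [9 * w'], where the new spread satisfies [2 * w' <= w + 2 * dev b.+1]. The
    potential [9 * (2 * w + S b.+1)] pays for this and for the next potential [9 * (2 * w' + S b)],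
    since [3 * w' <= 2 * w + 3 * dev b.+1] and [S_step] covers the errors. *)
Theorem peel_levels t q g l w : a + t <= beta ->
  symmetric q -> symmetric g -> subrel q e -> subrel g e -> (forall u v, q u v -> ~~ g u v) ->
  (forall v, l <= deg q v <= l + w) -> l + w <= U (a + t) ->
  (forall v, phi + 9 * (2 * w + S (a + t)) <= deg g v) ->
  exists g', [/\ symmetric g', subrel g' g,
    decomposable (t + (a + 6 + 2 * 10)) (union_rel q (diff_rel g g')) &
    forall v, deg g v <= deg g' v + 9 * (2 * w + S (a + t))].
Proof.
elim: t q g l w => [|t IH] q g l w; first by rewrite addn0 add0n; apply: peel_base.
rewrite addnS => tb qs gs qe ge qg dq lU gphi; set b := a + t in IH tb lU gphi *.
have dqb v : deg q v <= 2 ^ b.+1.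
  by case/andP: (dq v) => _ /leq_trans; apply; apply: leq_trans (U_le b.+1).
have dg v : deg g v <= 2 ^ beta by apply: leq_trans (ed v); apply: deg_sub.
have ab : a <= b by apply: leq_addr.
have [||||||x [xa xq xg]] := @balanced_bisection _ pi piK pi_fpf q (fun _ => g) b.+1 beta 20 qs dqb (fun _ => dg).
- by move=> _ v; apply: leq_trans (dg v); apply: subset_leq_card; apply/subsetP => u; rewrite !inE gs.
- exact: tb.
- by [].
- by move: ab a_large; clear; lia.
- by move: ab tb a_large; clear; lia.
- exact: beta1.
have {}xg := xg true.
have D0 : 0 < dev b.+1 by rewrite /dev !muln_gt0 expn_gt0 addn3.
(* The lower bound on the halved degrees is rounded up and the upper bound down, so rounding never
   widens the range. *)
pose l' := uphalf (l - dev b.+1); pose w' := (l + w + dev b.+1)./2 - l'.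
have w'w : 2 * w' <= w + 2 * dev b.+1 by rewrite /w' /l'; move: D0; clear; lia.
have lw' : l' + w' = (l + w + dev b.+1)./2 by rewrite /w' /l' subnKC //; move: D0; clear; lia.
have lU' : l' + w' <= U b by rewrite lw'; move: lU (U_step ab); clear; lia.
have bounds v : l' <= deg (crossing x q) v <= l' + w' /\ l' <= deg (within x q) v <= l' + w'.
  rewrite lw' /l'; have := dq v; rewrite -(deg_within_crossing x q v).
  by have := xq v; move: (deg _ v) (deg _ v); clear; lia.
have thr : 2 ^ (beta - 20) <= 2 ^ (beta - 10) by rewrite leq_exp2l //; clear; lia.
have Sb := S_step ab.
have [||||||h [hs hg hr]] := @regular_completion _ pi piK e d x (crossing x q) g l' w' mx xa.
- exact: crossing_sym.
- by move=> u v /andP [].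
- by move=> v; have [] := bounds v.
- exact: gs.
- exact: ge.
- move=> v; move: (splits_deg v xg) (gphi v) phi_large thr Sb w'w; rewrite -/b.
  by move: (2 ^ (beta - 20)) (2 ^ (beta - 10)) (dev b.+1) (S b) (S b.+1); clear; lia.
have hg' : subrel h g by move=> u v /hg /andP [].
have dh v : deg h v <= 9 * w'.
  by have /andP [h1 _] := (bounds v).1; rewrite -(leq_add2l l') -(hr v) leq_add2r.
have [|||||u v|v||v|g' [g's g'g dec dg']] := IH (within x q) (diff_rel g h) l' w'.
- exact: ltnW.
- exact: within_sym.
- exact: diff_rel_sym.
- by move=> u v /andP [/qe].
- by move=> u v /andP [/ge].
- by move=> /andP [/qg /negPf guv _]; rewrite /diff_rel guv.
- by have [] := bounds v.
- exact: lU'.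
- move: (gphi v) (dh v) (deg_diff_rel v hg') Sb w'w.
  by move: (dev b.+1) (S b) (S b.+1); clear; lia.
exists g'; split=> [//|u v /g'g /andP [] //||v].
  by rewrite addSn; apply: (peel qs hs hg qg hr g'g dec).
move: (dg' v) (dh v) (deg_diff_rel v hg') Sb w'w.
by move: (dev b.+1) (S b) (S b.+1); clear; lia.
Qed.
End Levels.

(** * Splitting a regular graph on four cells *)

Section FourCells.
Set Implicit Arguments. Unset Strict Implicit. Unset Printing Implicit Defensive.
Local Open Scope nat_scope.
Variables (n : nat) (pi : 'I_n -> 'I_n) (x y : 'I_n -> bool).
Hypotheses (piK : involutive pi) (xa : antipodal pi x) (ya : antipodal pi y).
Implicit Types (g h r : rel 'I_n).

Definition cell i j := [set v | (x v == i) && (y v == j)].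

Lemma card_cell i j : #|cell i j| = #|cell (~~ i) (~~ j)|.
Proof.
rewrite -(card_imset _ (inv_inj piK)); apply: eq_card => v; rewrite inE.
apply/imsetP/andP => [[u + ->]|[/eqP xv /eqP yv]].
  by rewrite inE xa ya => /andP [/eqP -> /eqP ->].
by exists (pi v); rewrite ?piK // inE xa ya xv yv !negbK !eqxx.
Qed.

Definition between r (C C' : {set 'I_n}) := \sum_(v in C) degin r C' v.

Lemma between_sym r C C' : symmetric r -> between r C C' = between r C' C.
Proof. exact: sum_degin_sym. Qed.

Variables (r : rel 'I_n) (rho : nat).
Hypotheses (rs : symmetric r) (rxy : forall u v, r u v -> (x u != x v) || (y u != y v)).
Hypothesis (rreg : forall v, deg r v = rho).

Lemma cell_regular i j : between r (cell i j) (cell (~~ i) j) +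
  between r (cell i j) (cell i (~~ j)) + between r (cell i j) (cell (~~ i) (~~ j)) = rho * #|cell i j|.
Proof.
rewrite -!big_split mulnC -sum_nat_const; apply: eq_bigr => v; rewrite inE => /andP [/eqP xv /eqP yv].
rewrite -(rreg v) /= /degin /deg -(cardsID [set u | y u == j] [set u | r v u]).
rewrite -(cardsID [set u | x u == i] ([set u | r v u] :\: _)) addnA; congr (_ + _ + _);
  apply: eq_card => u; rewrite !inE; have /implyP := @rxy v u; rewrite xv yv;
  by case: (r v u) => //=; rewrite ?andbF // ![_ == x u]eq_sym ![_ == y u]eq_sym;
    case: (x u) i (y u) j {xv yv} => [] [] [] [].
Qed.

(* Comparing the degree sums of the four cells, whose sizes agree in antipodal pairs. *)
Lemma cell_balance i j : between r (cell i j) (cell (~~ i) j) =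
  between r (cell (~~ i) (~~ j)) (cell i (~~ j)).
Proof.
have := cell_regular i j; have := cell_regular (~~ i) (~~ j).
have := cell_regular (~~ i) j; have := cell_regular i (~~ j).
rewrite !negbK -(card_cell i j) (card_cell i (~~ j)) negbK.
rewrite (between_sym (cell i (~~ j)) (cell i j)) // (between_sym (cell i (~~ j)) (cell (~~ i) j)) //.
rewrite (between_sym (cell (~~ i) j) (cell i j)) // (between_sym (cell (~~ i) (~~ j)) (cell i j)) //.
rewrite (between_sym (cell i (~~ j)) (cell (~~ i) (~~ j))) //.
rewrite (between_sym (cell (~~ i) j) (cell (~~ i) (~~ j))) //.
clear; lia.
Qed.

(** An edge changing only [x] cannot lie in a graph bipartite for [y], so its place is forced; an
    edge changing both labels may go to either graph. *)
Definition forced : rel 'I_n := within y (crossing x r).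
Definition flexible : rel 'I_n := crossing y (crossing x r).

Lemma forced_sym : symmetric forced.
Proof. exact: within_sym (crossing_sym x rs). Qed.

Lemma flexible_sym : symmetric flexible.
Proof. exact: crossing_sym (crossing_sym x rs). Qed.

Lemma degin_flexible i j v : v \in cell i j -> degin flexible (cell (~~ i) (~~ j)) v = deg flexible v.
Proof.
rewrite inE => /andP [/eqP xv /eqP yv]; rewrite (@deg_degin _ _ (cell (~~ i) (~~ j))) // => u.
rewrite inE /flexible /crossing xv yv => /andP [/andP [_]].
by case: (x u) i (y u) j {xv yv} => [] [] [] [].
Qed.

Lemma degin_forced i j v : v \in cell i j -> deg forced v = degin r (cell (~~ i) j) v.
Proof.
rewrite inE => /andP [/eqP xv /eqP yv]; apply: eq_card => u.
rewrite !inE /forced /within /crossing xv yv; case: (r v u); rewrite ?andbF //=.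
by case: (x u) i (y u) j {xv yv} => [] [] [] [].
Qed.

Variables (e : rel 'I_n) (d l w dl : nat).
Hypotheses (mx : mixing e d) (re : subrel r e).
Hypothesis forced_deg : forall v, l <= deg forced v <= l + w.
Hypothesis flexible_deg : forall v, dl <= deg flexible v.
Hypothesis dl_large : forall i j,
  1728 * (d * #|cell i j|) + 289 * (d * n) + 3264 * (9 * w) * n <= 3264 * (dl * n).

Let f v := l + 9 * w - deg forced v.

(** The flexible edges form two vertex-disjoint bipartite graphs, one for each pair of opposite
    cells; [k] names the pair on which [y v = k (+) x v]. The prescribed sums agree by [card_cell]
    and [cell_balance]. *)
Lemma flexible_factor k : exists h, [/\ symmetric h, subrel h flexible,
  forall u v, h u v -> y u = k (+) x u &
  forall v, deg h v = if y v == k (+) x v then f v else 0].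
Proof.
pose A := cell false k; pose B := cell true (~~ k).
have AB v : (v \in A :|: B) = (y v == k (+) x v).
  by rewrite !inE; case: (x v) (y v) (k) => [] [] [].
have disAB : [disjoint A & B].
  by rewrite -setI_eq0; apply/eqP/setP => v; rewrite !inE; case: (x v); rewrite /= ?andbF.
have [||||||h [hs hg hAB hf]] := @expander_factor_rel _ e flexible d #|B| dl (8 * w) A B f mx flexible_sym _ erefl disAB.
- by move=> u v /andP [/andP [/re]].
- by move=> v _; move: (forced_deg v); rewrite /f; clear; lia.
- have sf (C : {set 'I_n}) : (\sum_(v in C) f v) + \sum_(v in C) deg forced v = #|C| * (l + 9 * w).
    rewrite -big_split -sum_nat_const; apply: eq_bigr => v _ /=.
    by rewrite /f subnK //; move: (forced_deg v); clear; lia.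
  have := sf A; have := sf B; rewrite (eq_bigr _ (@degin_forced true (~~ k))).
  rewrite (eq_bigr _ (@degin_forced false k)) -/(between r A _) -/(between r B _).
  have := cell_balance false k; have := card_cell false k; rewrite /= -/A -/B => -> ->.
  by move=> <- /addIn ->.
- by move=> v vA; rewrite (degin_flexible vA).
- by move=> v vB; have := degin_flexible vB; rewrite negbK => ->.
- by move: (dl_large true (~~ k)); rewrite card_ord -/B; clear; lia.
exists h; split=> // [u v /hAB huv|v].
  by apply/eqP; rewrite -AB inE; case/orP: huv => /andP [-> _]; rewrite ?orbT.
case: ifP; rewrite -AB; first exact: hf.
move=> vAB; apply: eq_card0 => u; rewrite !inE; apply/negP => /hAB; move: vAB; rewrite inE.
by case: (v \in A); case: (v \in B).
Qed.

Theorem split_regular : decomposable 2 r.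
Proof.
have [h0 [h0s h0g h0c h0d]] := flexible_factor false.
have [h1 [h1s h1g h1c h1d]] := flexible_factor true.
pose H := union_rel forced (union_rel h0 h1).
have Hs : symmetric H := union_rel_sym forced_sym (union_rel_sym h0s h1s).
have Hr : subrel H r.
  by move=> u v /or3P [/andP [/andP []]|/h0g /andP [/andP []]|/h1g /andP [/andP []]].
have Hx u v : H u v -> x u != x v.
  by move=> /or3P [/andP [/andP []]|/h0g /andP [/andP []]|/h1g /andP [/andP []]].
have dH v : deg H v = l + 9 * w.
  rewrite deg_union_rel => [|u /andP [_ yy]]; last first.
    by apply/negP => /orP [/h0g|/h1g] /andP [_]; rewrite yy.
  rewrite deg_union_rel => [|u /h0c yv]; last by apply/negP => /h1c; rewrite yv; case: (x v).
  have -> : deg h0 v + deg h1 v = f v by rewrite h0d h1d; case: (x v); case: (y v); rewrite /= ?addn0.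
  by rewrite /f subnKC //; move: (forced_deg v); clear; lia.
have Hr' := deg_diff_rel _ Hr.
apply: (@decomposable_eq _ _ (union_rel H (diff_rel r H))).
  move=> u v; rewrite /union_rel /diff_rel -/(H u v); have /implyP := Hr u v.
  by rewrite -/(union_rel h0 h1 u v) -/(union_rel forced _ u v) -/H; case: (H u v); case: (r u v).
apply: (@decomposableU _ 1 1).
- by move=> u v Huv; rewrite /diff_rel Huv andbF.
- exact: (decomposable1 Hs Hx dH).
apply: (@decomposable1 _ _ y (rho - (l + 9 * w))).
- exact: diff_rel_sym.
- move=> u v /andP [ruv nH]; apply: contra nH => /eqP yuv; apply/orP; left.
  by have := rxy ruv; rewrite /forced /within /crossing ruv yuv eqxx orbF => ->.
by move=> v; rewrite -(rreg v) -(Hr' v) dH addnK.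
Qed.
End FourCells.

(** * Numerical estimates *)

Section Capacity.
Set Implicit Arguments. Unset Strict Implicit. Unset Printing Implicit Defensive.
Local Open Scope nat_scope.

Lemma poly_le_exp k : 32 <= k ->
  9 * (2 * k + 4) * 2 ^ 20 <= 2 ^ k /\ 3 * (2 * k + 4) * ((2 * k + 1) * (2 * k)) <= 2 ^ k.
Proof.
elim: k => // k IH; rewrite leq_eqVlt => /orP [/eqP <- {IH}|]; last first.
  rewrite ltnS => k32; have [IH1 IH2] := IH k32; rewrite (expnS 2 k).
  split.
    apply: (leq_trans _ (leq_mul (leqnn 2) IH1)); rewrite mulnA leq_mul2r; apply/orP; right.
    by move: k32; clear; lia.
  apply: (leq_trans _ (leq_mul (leqnn 2) IH2)); rewrite -(subnKC k32); move: (k - 32) => i.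
  by clear; nia.
split.
  have -> : 2 ^ 32 = 2 ^ 12 * 2 ^ 20 by rewrite -expnD.
  by rewrite leq_mul2r; apply/orP; right.
apply: (@leq_trans (2 ^ 8 * (2 ^ 7 * 2 ^ 6))); first by apply: leq_mul => //; apply: leq_mul.
by rewrite -!expnD leq_exp2l.
Qed.

(** In [2 ^ b = 2 ^ uphalf b * 2 ^ b./2] the first factor is the power in [dev b]; the second beats
    the polynomial. *)
Lemma dev_small b : 64 <= b -> 3 * dev b <= 2 ^ (b - 20) /\ dev b * (b * b.-1) <= 2 ^ b.
Proof.
move=> b64; have k32 : 32 <= b./2 by rewrite -(doubleK 32) half_leq.
have [h1 h2] := poly_le_exp k32.
have b2 : b <= 2 * b./2 + 1.
  by rewrite -[X in X <= _](odd_double_half b) addnC mul2n leq_add2l; case: (odd b).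
have Eb : 2 ^ b = 2 ^ uphalf b * 2 ^ b./2.
  by rewrite -expnD uphalf_half -addnA addnn odd_double_half.
split.
  rewrite -(@leq_pmul2r (2 ^ 20)) ?expn_gt0 // -expnD subnK; last by move: b64; clear; lia.
  rewrite Eb /dev mulnC; apply: (leq_trans _ (leq_mul (leqnn (2 ^ uphalf b)) h1)).
  have : b + 3 <= 2 * b./2 + 4 by move: b2; clear; lia.
  move/(leq_mul (leqnn (9 * (2 ^ 20 * 2 ^ uphalf b)))).
  by move: (2 ^ 20) (2 ^ uphalf b) => u v; clear; lia.
rewrite Eb /dev; apply: (leq_trans _ (leq_mul (leqnn (2 ^ uphalf b)) h2)).
rewrite -mulnA mulnC -mulnA leq_mul2l; apply/orP; right.
have h3 : b + 3 <= 2 * b./2 + 4 by move: b2; clear; lia.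
have h4 : b.-1 <= 2 * b./2 by move: b2; clear; lia.
by rewrite mulnC; apply: leq_mul; [rewrite leq_mul2l h3 | apply: leq_mul].
Qed.

(* A graph of maximum degree at most [capacity b] has degree at most [2^64] after [b - 64]
   bisections, each with the error [dev] of [balanced_bisection]. *)
Fixpoint capacity b := if b is b'.+1 then 2 * capacity b' - (if b' < 64 then 0 else dev b) else 1.

Lemma capacity_le b : capacity b <= 2 ^ b.
Proof. by elim: b => //= b IH; rewrite expnS leq_subLR (leq_trans _ (leq_addl _ _)) // leq_mul2l IH. Qed.

Lemma capacity64 b : b <= 64 -> capacity b = 2 ^ b.
Proof. by elim: b => // b IH b64 /=; rewrite b64 subn0 IH ?expnS // ltnW. Qed.

(** That is, [capacity b >= 2 ^ b * (1/2 + 1/b)]. The relative loss at [b] is at most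
    [1 / (b (b - 1))], which telescopes as [1 / (b - 1) - 1 / b]. *)
Lemma capacity_ge b : 64 <= b -> (b + 2) * 2 ^ b <= 2 * b * capacity b.
Proof.
elim: b => // b IH; rewrite leq_eqVlt => /orP [/eqP <-|b64].
  by rewrite (capacity64 (leqnn 64)) leq_mul2r; apply/orP; right.
rewrite ltnS in b64; have /IH {}IH := b64; have [_] := dev_small (leqW b64).
have bF : (b < 64) = false by rewrite ltnNge b64.
rewrite [capacity b.+1]/= bF expnS.
have b0 : 0 < b by apply: leq_trans b64.
move=> D; rewrite -(leq_pmul2l b0) mulnBr.
move: D IH; move: (capacity b) (dev b.+1) (2 ^ b) => U D P; clear => D1 D2.
have h1 : 2 * b.+1 * ((b + 2) * P) <= 2 * b.+1 * (2 * b * U) by rewrite leq_mul2l D2 orbT.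
rewrite mulnBr leq_subRL.
  by move: h1 D1; lia.
by move: h1 D1; nia.
Qed.

Lemma capacity_half b : 64 <= b -> 2 ^ b <= 2 * capacity b.
Proof.
move=> b64; have b0 : 0 < b by apply: leq_trans b64.
rewrite -(leq_pmul2l b0); move: (capacity_ge b64); move: (2 ^ b) (capacity b); clear; lia.
Qed.

Lemma capacity_step b : 64 <= b -> capacity b.+1 + dev b.+1 <= 2 * capacity b.
Proof.
move=> b64; have bF : (b < 64) = false by rewrite ltnNge b64.
rewrite [capacity b.+1]/= bF subnK //.
apply: leq_trans (capacity_half b64).
have [h _] := dev_small (leqW b64).
apply: (@leq_trans (2 ^ (b.+1 - 20))); first by apply: leq_trans h; rewrite leq_pmull.
by rewrite leq_exp2l //; clear; lia.
Qed.
End Capacity.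

Section Main.
Set Implicit Arguments. Unset Strict Implicit. Unset Printing Implicit Defensive.
Local Open Scope nat_scope.

Lemma double_exp_ge m : 52 <= m -> 2 * (m + 40) + 6 <= 2 ^ m.
Proof.
move=> m52; have := ltn_expl (m - 2) (isT : 1 < 2).
have -> : 2 ^ m = 4 * 2 ^ (m - 2).
  by rewrite (_ : 4 = 2 ^ 2) // -expnD subnKC // (leq_trans _ m52).
by move: (2 ^ (m - 2)) m52; clear; lia.
Qed.

Lemma triple_exp_ge m : 20 <= m -> 3 * (m + 20) + 2 <= 2 ^ m.
Proof.
move=> m20; have := ltn_expl (m - 4) (isT : 1 < 2).
have -> : 2 ^ m = 16 * 2 ^ (m - 4).
  by rewrite (_ : 16 = 2 ^ 4) // -expnD subnKC // (leq_trans _ m20).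
by move: (2 ^ (m - 4)) m20; clear; lia.
Qed.

(** The fixed perfect matching pairs [v] with [n - 1 - v], adjacent or not. *)
Lemma rev_ord_fpf n (v : 'I_n) : ~~ odd n -> rev_ord v != v.
Proof.
move=> ev; apply/eqP => /(congr1 val) /= E; move: (ltn_ord v) ev E => /=.
by move: (val v); clear; lia.
Qed.

(** The error [tau / 2] from [x] is halved by [y], which adds another [tau / 2]: in all
    [3 * tau / 4]. The graphs split by [y] keep the edges into one class of [x] and are not
    symmetric. *)
Lemma cell_degree n (e : rel 'I_n) x y d tau :
  (forall v, deg e v = d) -> splits x e tau ->
  (forall k, splits y (fun u v => e u v && (x v == k)) tau) ->
  forall i j v, d <= 4 * degin e (cell x y i j) v + 3 * tau /\
                4 * degin e (cell x y i j) v <= d + 3 * tau.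
Proof.
move=> ed xs ys i j v; pose gk k : rel 'I_n := fun u v => e u v && (x v == k).
have Ex k : deg (gk k) v = if k == x v then deg (within x e) v else deg (crossing x e) v.
  case: eqP => [->|/eqP kx]; apply: eq_card => u; rewrite !inE /gk /within /crossing eq_sym //.
  by case: (e v u) => //=; case: (x u) k (x v) kx => [] [] [].
have Ey : degin e (cell x y i j) v =
    if j == y v then deg (within y (gk i)) v else deg (crossing y (gk i)) v.
  case: eqP => [->|/eqP jy]; apply: eq_card => u; rewrite !inE /gk /within /crossing.
    by rewrite andbC [y v == _]eq_sym andbA.
  by rewrite andbC -andbA; case: (e v u) => //=; case: (x u == i); case: (y u) j (y v) jy => [] [] [].
have := xs v; have := ys i v; have := Ex i; rewrite -/(gk i) Ey.
have := deg_within_crossing x e v; have := deg_within_crossing y (gk i) v; rewrite ed.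
by case: eqP; case: eqP => _ _; clear; lia.
Qed.

Lemma cell_size n (e : rel 'I_n) x y d tau i j : symmetric e -> (forall v, deg e v = d) ->
  (forall v, 4 * degin e (cell x y i j) v <= d + 3 * tau) ->
  4 * (d * #|cell x y i j|) <= (d + 3 * tau) * n.
Proof.
move=> es ed h; have -> : d * #|cell x y i j| = \sum_v degin e (cell x y i j) v.
  transitivity (\sum_(v in [set: 'I_n]) degin e (cell x y i j) v).
    rewrite sum_degin_sym // mulnC -sum_nat_const; apply: eq_bigr => v _.
    by rewrite -(ed v); apply: deg_degin => u; rewrite inE.
  by apply: eq_bigl => v; rewrite inE.
rewrite big_distrr /= mulnC -[X in _ <= X * _](card_ord n) -sum_nat_const.
exact: leq_sum.
Qed.

Lemma regular_bipartite_decomposition n d (e : rel 'I_n) :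
  symmetric e -> irreflexive e -> (forall v, deg e v = d) -> mixing e d -> ~~ odd n ->
  100 <= trunc_log 2 d ->
  exists k, k <= trunc_log 2 d + 36 /\ decomposable k e.
Proof.
move=> es ei ed mx n_even; set ell := trunc_log 2 d => ell100.
have d0 : 0 < d by rewrite lt0n; apply: contraTneq ell100 => E; rewrite /ell E.
have dlo : 2 ^ ell <= d by apply: trunc_logP.
have dhi : d < 2 ^ ell.+1 by apply: trunc_log_ltn.
pose beta := ell.+1; pose T := 2 ^ (beta - 20).
have ebeta v : deg e v <= 2 ^ beta by rewrite ed ltnW.
have T1 : 2 ^ beta = 1024 * (1024 * T).
  by rewrite /T (_ : 1024 = 2 ^ 10) // -!expnD; congr (2 ^ _); move: ell100; rewrite /beta; clear; lia.
have T0 : 2 ^ ell = 512 * (1024 * T).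
  by move: T1; rewrite /beta expnS; move: (2 ^ ell) T; clear; lia.
have T10 : 2 ^ (beta - 10) = 1024 * T.
  by rewrite /T (_ : 1024 = 2 ^ 10) // -!expnD; congr (2 ^ _); move: ell100; rewrite /beta; clear; lia.
have T19 : 2 ^ (beta - 19) = 2 * T.
  by rewrite /T -expnS; congr (2 ^ _); move: ell100; rewrite /beta; clear; lia.
have [C EC] : exists C, C = 2 * (64 + 6 + 2 * 10) * 2 ^ 64 by eexists.
(* [C] pays for the binary words at the end; the power grows by [2 ^ (b - 19)] per level, which
   covers [3 * dev b.+1] by [dev_small]. *)
pose S b := C + 2 ^ (b - 19).
have Sbeta : S beta <= 3 * T.
  rewrite /S T19 -[3]/(1 + 2) mulnDl leq_add2r mul1n EC.
  apply: (@leq_trans (2 ^ 8 * 2 ^ 64)); first by rewrite leq_mul2r; apply/orP; right.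
  by rewrite -expnD leq_exp2l //; move: ell100; rewrite /beta; clear; lia.
have Tbig : 64 <= T.
  by rewrite (_ : 64 = 2 ^ 6) // leq_exp2l //; move: ell100; rewrite /beta; clear; lia.
have piK : involutive (@rev_ord n) := @rev_ordK n.
have pi_fpf v : @rev_ord n v != v := rev_ord_fpf v n_even.
have beta1 : 2 * beta + 6 <= 2 ^ (beta - 2 * 20).
  have := @double_exp_ge (beta - 2 * 20); rewrite subnK; last by move: ell100; rewrite /beta; clear; lia.
  by apply; move: ell100; rewrite /beta; clear; lia.
have beta2 : 3 * beta + 2 <= 2 ^ (beta - 2 * 10).
  have := @triple_exp_ge (beta - 2 * 10); rewrite subnK; last by move: ell100; rewrite /beta; clear; lia.
  by apply; move: ell100; rewrite /beta; clear; lia.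
have beta3 : 8 * (64 + 6 + 2 * 10) <= 2 ^ beta by rewrite T1; move: Tbig; clear; lia.
have b64 : 64 <= beta by move: ell100; rewrite /beta; clear; lia.
pose nil : rel 'I_n := fun _ _ => false.
have nil_deg v : deg nil v <= 2 ^ 64.
  by rewrite /deg eq_card0 // => u; rewrite inE.
(* Only [e] has to be split; the empty graph takes the place of [q], with [b = 64] so that
   [2 * c < b] for [c = 20]. *)
have [x [xa _ xs]] : exists x, [/\ antipodal (@rev_ord n) x, splits x nil (dev 64) & splits x e (3 * T)].
  have [|||||||x [h1 h2 h3]] := @balanced_bisection _ (@rev_ord n) piK pi_fpf nil (fun _ => e) 64 beta 20 _ nil_deg (fun _ => ebeta).
  - by [].
  - by move=> _ v; rewrite (leq_trans _ (ebeta v)) //; apply/subset_leq_card/subsetP => u; rewrite !inE es.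
  - exact: b64.
  - by [].
  - by [].
  - by apply: leq_trans b64.
  - exact: beta1.
  - by exists x; split=> //; apply: (h3 true).
pose gk k : rel 'I_n := fun u v => e u v && (x v == k).
have [y [ya _ ys]] : exists y, [/\ antipodal (@rev_ord n) y, splits y nil (dev 64) & forall k, splits y (gk k) (3 * T)].
  have [||||||||y h] := @balanced_bisection _ (@rev_ord n) piK pi_fpf nil gk 64 beta 20 _ nil_deg.
  - by [].
  - by move=> k v; rewrite (leq_trans _ (ebeta v)) //; apply: deg_sub => a b /andP [].
  - move=> k v; rewrite (leq_trans _ (ebeta v)) //; apply/subset_leq_card/subsetP => u.
    by rewrite !inE es => /andP [].
  - exact: b64.
  - by [].
  - by [].
  - by apply: leq_trans b64.
  - exact: beta1.
  - by exists y.
have cd := cell_degree ed xs ys; have cs i j := cell_size es ed (fun v => (cd i j v).2).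
pose q0 := within y (within x e); pose g0 := diff_rel e q0.
have q0s : symmetric q0 by apply/within_sym/within_sym.
have q0e : subrel q0 e by move=> u v /andP [/andP []].
have g0s : symmetric g0 by apply: diff_rel_sym.
have g0e : subrel g0 e by move=> u v /andP [].
have q0g0 u v : q0 u v -> ~~ g0 u v by rewrite /g0 /diff_rel => ->; rewrite andbF.
have q0d v : deg q0 v = degin e (cell x y (x v) (y v)) v.
  apply: eq_card => u; rewrite !inE /q0 /within [x v == _]eq_sym [y v == _]eq_sym.
  by case: (e v u); rewrite ?andbF ?andbT.
have g0d v : deg g0 v + deg q0 v = d by rewrite deg_diff_rel ?ed.
pose l := (d - 9 * T) %/ 4; pose w := (d + 9 * T) %/ 4 - l.
have lw : l + w = (d + 9 * T) %/ 4 by rewrite /w subnKC // /l; clear; lia.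
have w9 : 4 * w <= 18 * T + 3 by rewrite /w /l; clear; lia.
have q0lw v : l <= deg q0 v <= l + w.
  by rewrite lw q0d /l; move: (cd (x v) (y v) v); clear; lia.
have Ecap : 64 + (beta - 64) = beta by rewrite subnKC.
(* [73/100] lies between [2 * 1153 / 3264 < 0.707], which the completions need up to the splitting
   error, and the [3/4] available in [g0]. *)
have [||||||||||||g [gs gg0 dec gd]] := @peel_levels n (@rev_ord n) e d piK pi_fpf mx 64 beta (73 * d %/ 100)
   capacity S ei ebeta capacity_le capacity_step _ _ _ isT beta1 beta2 beta3 (beta - 64) q0 g0 l w.
- by rewrite -EC; apply: leq_addr.
- move=> b b64'; rewrite /S -[C + _ + _]addnA leq_add2l.
  have [h _] := dev_small (leqW b64'); rewrite (_ : b.+1 - 19 = (b - 19).+1); last by move: b64'; clear; lia.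
  rewrite expnS mul2n -addnn leq_add2l; apply: leq_trans h _.
  by rewrite leq_exp2l //; clear; lia.
- by rewrite T10; move: dlo; rewrite T0; move: Tbig; clear; lia.
- by rewrite Ecap.
- exact: q0s.
- exact: g0s.
- exact: q0e.
- exact: g0e.
- exact: q0g0.
- exact: q0lw.
- rewrite Ecap lw; have := capacity_half b64; rewrite T1; move: dhi; rewrite -/beta T1.
  by move: Tbig (capacity beta); clear; lia.
- move=> v; rewrite Ecap; move: (g0d v) (q0lw v) Sbeta w9; rewrite lw; move: dlo; rewrite T0.
  by move: (S beta) Tbig; clear; lia.
rewrite Ecap in gd; set u := 9 * _ in gd.
(* So each vertex loses fewer than [d / 2 ^ 12] edges of [g0], as [2 ^ beta <= 2 * d]. *)
have uT : u <= 109 * T by rewrite /u; move: w9 Sbeta Tbig; move: (S beta); clear; lia.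
have [rho0 dec_reg] := decomposable_regular dec.
have diffd v : deg (diff_rel g0 g) v + deg g v = deg g0 v := deg_diff_rel v gg0.
have qdiff a b : q0 a b -> ~~ diff_rel g0 g a b by move/q0g0/negPf => E; rewrite /diff_rel E.
have greg v : deg g v = d - rho0.
  move: (dec_reg v) (g0d v) (diffd v); rewrite deg_union_rel; last by move=> b; apply: qdiff.
  by clear; lia.
have ge : subrel g e by move=> a b /gg0 /g0e.
have gxy a b : g a b -> (x a != x b) || (y a != y b).
  move/gg0 => /andP [eab]; apply: contraR; rewrite negb_or !negbK => /andP [xab yab].
  by rewrite /q0 /within eab xab yab.
have gcell i j v : (i != x v) || (j != y v) ->
    degin e (cell x y i j) v <= degin g (cell x y i j) v + u.
  move=> ij; apply: (@leq_trans (degin g (cell x y i j) v + deg (diff_rel g0 g) v)).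
    apply: leq_trans (leq_of_leqif (leq_card_setU _ _)); apply/subset_leq_card/subsetP => b.
    rewrite !inE /diff_rel /g0 /diff_rel /q0 /within => /andP [/andP [/eqP xb /eqP yb] evb].
    subst i j; move: ij; rewrite evb !eqxx /= [x b == _]eq_sym [y b == _]eq_sym.
    by case: (x v == x b); case: (y v == y b); case: (g v b).
  by rewrite leq_add2l; move: (gd v) (diffd v); clear; lia.
pose l1 := (d - 9 * T) %/ 4 - u; pose w1 := (d + 9 * T) %/ 4 - l1.
have lw1 : l1 + w1 = (d + 9 * T) %/ 4 by rewrite /w1 subnKC // /l1; clear; lia.
have own v : v \in cell x y (x v) (y v) by rewrite inE !eqxx.
have dec2 : decomposable 2 g.
  apply: (@split_regular _ (@rev_ord n) x y piK xa ya g (d - rho0) gs gxy greg e d l1 w1 l1 mx ge).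
  - move=> v; rewrite (degin_forced _ (own v)) lw1.
    have := gcell (~~ x v) (y v) v; have -> : ~~ x v != x v by case: (x v).
    have := degin_sub v ge (subxx (cell x y (~~ x v) (y v))); move: (cd (~~ x v) (y v) v).
    by rewrite /l1; clear; lia.
  - move=> v; have h : degin g (cell x y (~~ x v) (~~ y v)) v <= deg (flexible x y g) v.
      apply/subset_leq_card/subsetP => b; rewrite !inE /flexible /crossing.
      case/andP => /andP [/eqP -> /eqP ->] ->.
      by case: (x v); case: (y v).
    have := gcell (~~ x v) (~~ y v) v; have -> : ~~ x v != x v by case: (x v).
    by move: h (cd (~~ x v) (~~ y v) v); rewrite /l1; clear; lia.
  (* [cell_size] turns [1728 * d * #|cell|] into [432 * (d + 9 * T) * n]. With [l1] close to
     [d / 4], the leading coefficients compare as [432 + 289 < 816]. *)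
  - have key : 432 * (d + 9 * T) + 289 * d + 3264 * (9 * w1) <= 3264 * l1.
      by rewrite /w1 /l1; move: dlo uT Tbig; rewrite T0; clear; lia.
    move=> i j; move: (cs i j) (leq_mul key (leqnn n)); clear.
    by move: (#|_|) l1 w1 => m l1 w1; lia.
(* Bisections, bits of the binary words, and the two final graphs: [trunc_log 2 d + 29] in all. *)
exists ((beta - 64 + (64 + 6 + 2 * 10)) + 2); split.
  by rewrite /beta; move: ell100; clear; lia.
apply: (@decomposable_eq _ _ (union_rel (union_rel q0 (diff_rel g0 g)) g)).
  move=> a b; have /implyP := q0e a b; have /implyP := gg0 a b.
  rewrite /union_rel /diff_rel /g0 /diff_rel.
  by case: (q0 a b); case: (g a b); case: (e a b).
apply: decomposableU dec dec2 => a b /orP [/q0g0 ng|/andP [] //].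
by apply: contra ng; apply: gg0.
Qed.
End Main.

Theorem theorem1p3 :
  exists d0 : nat, (0 < d0)%N /\
  forall (d n : nat), (d0 <= d)%N -> (d.+1 <= n)%N -> ~~ odd n ->
  forall (lam : algC) (e : rel 'I_n),
    nd_lambda_graph d lam e -> lam <= d%:R / 12%:R ->
    exists (k : nat) (H : 'I_k -> rel 'I_n),
      (k <= trunc_log 2 d + 36)%N /\ reg_bip_decomposition e H.
Proof.
have [d0 Ed0] : exists d0, d0 = (2 ^ 100)%N by eexists.
exists d0; split=> [|d n d0d dn n_even lam e G lamd]; first by rewrite Ed0 expn_gt0.
have ell100 : (100 <= trunc_log 2 d)%N by apply: trunc_log_max; rewrite -?Ed0.
have d_gt0 : (0 < d)%N by apply: leq_trans d0d; rewrite Ed0 expn_gt0.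
have n_gt0 : (0 < n)%N by apply: leq_trans dn.
have [[es ei] [er _]] := G.
have mix := expander_mixing n_gt0 d_gt0 G lamd.
have [k [kd [H HP]]] :=
  regular_bipartite_decomposition es (fun v => negbTE (ei v)) er mix n_even ell100.
by exists k, H.
Qed.
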